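(* Let $\mathcal{R}$ be an ergodic hyperfinite equivalence relation of type III$_0$ on a standard $\sigma$-finite measure space $(X,\mathfrak{B},\mu)$ whose associated flow has Property B. Then $\mathcal{R}$ is not of product type.
   Context: **Flows and Property B.** A measurable flow on a standard $\sigma$-finite measure space $(Y,\mathfrak{C},\nu)$ is a one-parameter group $\{F_t\}_{t\in\mathbb{R}}$ of nonsingular automorphisms such that $(y,t)\mapsto F_t(y)$ is measurable. For $A\in\mathfrak{C}$ of positive measure and $s,\delta>0$ put $\Lambda_{F,\delta,s}(A)=\{y\in A:\ \exists t\in(e^{s-\delta},e^{s+\delta})\cup(-e^{s+\delta},-e^{s-\delta}),\ F_t(y)\in A\}$. The flow has Property B if there is a measurable set $A\subseteq Y$ of positive measure such that for all $\delta>0$, $\limsup_{s\to\infty}\nu(\Lambda_{F,\delta,s}(A))=0$. Property B is invariant under conjugacy of flows. **Equivalence relations.** A countable measured equivalence relation $\mathcal{R}$ on $(X,\mathfrak{B},\mu)$ has countable classes, is a measurable subset of $X\times X$, and saturations of null sets are null. It is ergodic if every invariant measurable set is null or conull; finite if almost all classes are finite; hyperfinite if, up to a null set, it is an increasing union of finite relations. The full group $[\mathcal{R}]$ is the group of nonsingular automorphisms $\phi$ with $(x,\phi(x))\in\mathcal{R}$ for a.e. $x$. $\delta$ denotes the Radon-Nikodym cocycle of $\mu$ with respect to $\mathcal{R}$, with the convention $\delta(\phi(x),x)=\frac{d\mu\circ\phi}{d\mu}(x)$ for $\phi\in[\mathcal{R}]$. $\mathcal{R}$ is of type III if there is no $\sigma$-finite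 $\mathcal{R}$-invariant measure equivalent to $\mu$, and of type III$_0$ if it is of type III and its asymptotic ratio set is $\{0,1\}$. **Associated flow.** Replacing $\mu$ by an equivalent measure, one may take $\mu$ to be lacunary: there is $\varepsilon>0$ such that for $(x,y)\in\mathcal{R}$ either $\log\delta(x,y)=0$ or $|\log\delta(x,y)|>\varepsilon$. Put $\xi(x)=\min\{\log\delta(x',x): (x',x)\in\mathcal{R},\ \log\delta(x',x)>0\}$, and let $\mathcal{S}$ be the relation $(x,y)\in\mathcal{S}$ iff $(x,y)\in\mathcal{R}$ and $\delta(x,y)=1$. Let $X_0$ be the quotient of $X$ by the $\sigma$-algebra $\mathfrak{B}(\mathcal{S})$ of $\mathcal{S}$-invariant sets (the space of ergodic components of $\mathcal{S}$), $\pi:X\to X_0$ the quotient map, $\mu_0=\mu\circ\pi^{-1}$. The function $\xi$ is $\mathfrak{B}(\mathcal{S})$-measurable and so is regarded as a function on $X_0$. An ergodic automorphism $T$ of $X_0$ is defined by $T(\pi(x))=\pi(x')$, where $(x,x')\in\mathcal{R}$ and $\log\delta(x',x)=\xi(\pi(x))$. The associated flow of $\mathcal{R}$ is (up to conjugacy) the flow built under the function $\xi$ with base automorphism $T$: on $\{(z,u)\in X_0\times\mathbb{R}: 0\le u<\xi(z)\}$ with the restriction of $\mu_0\times$Lebesgue, a point moves upward at unit speed and $(z,\xi(z))$ is identified with $(T(z),0)$. **Product type.** Two countable measured equivalence relations $\mathcal{R}$ on $(X,\mathfrak{B},\mu)$ and $\mathcal{R}'$ on $(X',\mathfrak{B}',\mu')$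 are orbit equivalent if there is an isomorphism $S$ (nonsingular in both directions) of the measure spaces with $S(\mathcal{R}(x))=\mathcal{R}'(Sx)$ for $\mu$-a.e. $x$. $\mathcal{R}$ is of product type if it is orbit equivalent to the tail equivalence relation on some infinite product probability space $\prod_{n\ge1}(X_n,\mu_n)$, where $X_n=\{0,1,\dots,k_n-1\}$, $k_n\ge2$, and $\mu_n$ is a probability measure on $X_n$ charging every point; here $x,y$ are tail equivalent iff there is $n\ge 1$ with $x_i=y_i$ for all $i>n$. *)

(* Defs.v *)
From HB Require Import structures.
From mathcomp Require Import all_boot all_order all_algebra.
From mathcomp Require Import all_classical all_reals all_analysis.

Set Implicit Arguments.
Unset Strict Implicit.
Unset Printing Implicit Defensive.

Import Order.TTheory GRing.Theory Num.Theory.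
Import numFieldNormedType.Exports.

Local Open Scope classical_set_scope.
Local Open Scope ring_scope.

(* [X] is Borel isomorphic to a Polish space. *)
Definition standard_borel (R : realType) d (X : measurableType d) : Prop :=
  exists (P : completePseudoMetricType R) (f : X -> P),
    [/\ hausdorff_space P, @second_countable P, bijective f &
        d.-measurable = [set f @^-1` B | B in <<s @open P >>]].

Definition equivalent_measures d (X : measurableType d) (R : realType)
    (mu nu : set X -> \bar R) : Prop :=
  mu `<< nu /\ nu `<< mu.

(* An automorphism is everywhere defined and bijective.  An almost everywhere
   defined one can be brought into this form by restricting it to a conull
   invariant set and extending by the identity. *)
Definition nonsingular_aut d (X : measurableType d) (R : realType)
    (mu : set X -> \bar R) (phi : X -> X) : Prop :=
  exists psi : X -> X,
    [/\ cancel phi psi, cancel psi phi,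
        measurable_fun [set: X] phi, measurable_fun [set: X] psi &
        forall A, measurable A -> (mu (phi @^-1` A) = 0%E <-> mu A = 0%E)].

(* Isomorphism modulo null sets, nonsingular in both directions: [S] restricts
   to a bijection of the conull sets [T (S x) = x] and [S (T y) = y]. *)
Definition iso_mod0 d d' (X : measurableType d) (Y : measurableType d')
    (R : realType) (mu : set X -> \bar R) (nu : set Y -> \bar R)
    (S : X -> Y) : Prop :=
  exists T : Y -> X,
    [/\ measurable_fun [set: X] S, measurable_fun [set: Y] T,
        {ae mu, forall x, T (S x) = x}, {ae nu, forall y, S (T y) = y} &
        forall B, measurable B -> (mu (S @^-1` B) = 0%E <-> nu B = 0%E)].

Definition eqv_class (X : Type) (E : set (X * X)) (x : X) : set X :=
  [set y | E (x, y)].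

Definition saturation (X : Type) (E : set (X * X)) (A : set X) : set X :=
  [set y | exists2 x, A x & E (x, y)].

Definition invariant_set (X : Type) (E : set (X * X)) (A : set X) : Prop :=
  forall x y, E (x, y) -> A x -> A y.

Record countable_measured_eqv d (X : measurableType d) (R : realType)
    (mu : set X -> \bar R) (E : set (X * X)) : Prop := CountableMeasuredEqv {
  eqv_refl : forall x, E (x, x) ;
  eqv_sym : forall x y, E (x, y) -> E (y, x) ;
  eqv_trans : forall x y z, E (x, y) -> E (y, z) -> E (x, z) ;
  eqv_countable : forall x, countable (eqv_class E x) ;
  eqv_measurable : measurable E ;
  eqv_null : forall A, measurable A -> mu A = 0%E ->
    mu.-negligible (saturation E A) }.

Definition ergodic_eqv d (X : measurableType d) (R : realType)
    (mu : set X -> \bar R) (E : set (X * X)) : Prop :=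
  forall A, measurable A -> invariant_set E A ->
    mu A = 0%E \/ mu (~` A) = 0%E.

Definition finite_eqv d (X : measurableType d) (R : realType)
    (mu : set X -> \bar R) (E : set (X * X)) : Prop :=
  {ae mu, forall x, finite_set (eqv_class E x)}.

Definition hyperfinite d (X : measurableType d) (R : realType)
    (mu : set X -> \bar R) (E : set (X * X)) : Prop :=
  exists En : nat -> set (X * X),
    [/\ forall n, countable_measured_eqv mu (En n),
        forall n, finite_eqv mu (En n),
        forall n, En n `<=` En n.+1 &
        exists N, [/\ measurable N, mu N = 0%E &
          forall x y, ~ N x -> ~ N y ->
            (E (x, y) <-> exists n, En n (x, y))]].

Definition full_group d (X : measurableType d) (R : realType)
    (mu : set X -> \bar R) (E : set (X * X)) : set (X -> X) :=
  [set phi | nonsingular_aut mu phi /\ {ae mu, forall x, E (x, phi x)}].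

(* The defining property [delta (phi x, x) = d(mu o phi)/d mu (x)] is stated
   in integrated form.  The values of [delta] off [E] are irrelevant. *)
Record RN_cocycle d (X : measurableType d) (R : realType)
    (mu : set X -> \bar R) (E : set (X * X)) (delta : X * X -> R) : Prop :=
  RNCocycle {
  RN_measurable : measurable_fun [set: X * X] delta ;
  RN_gt0 : forall p, E p -> 0 < delta p ;
  RN_cocycle_eq : forall x y z, E (x, y) -> E (y, z) ->
    delta (x, z) = delta (x, y) * delta (y, z) ;
  RN_derivative : forall phi, full_group mu E phi ->
    forall A, measurable A ->
      mu (phi @` A) = (\int[mu]_(x in A) (delta (phi x, x))%:E)%E }.

Definition invariant_measure d (X : measurableType d) (R : realType)
    (E : set (X * X)) (nu : set X -> \bar R) : Prop :=
  forall phi, full_group nu E phi ->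
    forall A, measurable A -> nu (phi @` A) = nu A.

Definition type_III d (X : measurableType d) (R : realType)
    (mu : set X -> \bar R) (E : set (X * X)) : Prop :=
  ~ exists nu : {sigma_finite_measure set X -> \bar R},
      equivalent_measures nu mu /\ invariant_measure E nu.

Definition asymptotic_ratio_set d (X : measurableType d) (R : realType)
    (mu : set X -> \bar R) (E : set (X * X)) (delta : X * X -> R) : set R :=
  [set r | 0 <= r /\
    forall e : R, 0 < e -> forall A, measurable A -> (0 < mu A)%E ->
      exists B phi,
        [/\ measurable B, (0 < mu B)%E & B `<=` A] /\
        [/\ full_group mu E phi, phi @` B `<=` A &
            forall x, B x -> `|delta (phi x, x) - r| < e]].

Definition type_III0 d (X : measurableType d) (R : realType)
    (mu : set X -> \bar R) (E : set (X * X)) : Prop :=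
  type_III mu E /\
  exists2 delta, RN_cocycle mu E delta &
    asymptotic_ratio_set mu E delta = [set 0; 1].

Record measurable_flow d (Y : measurableType d) (R : realType)
    (nu : set Y -> \bar R) (F : R -> Y -> Y) : Prop := MeasurableFlow {
  flow0 : forall y, F 0 y = y ;
  flowD : forall s t y, F (s + t) y = F s (F t y) ;
  flow_aut : forall t, nonsingular_aut nu (F t) ;
  flow_measurable : measurable_fun [set: Y * R] (fun p => F p.2 p.1) }.

Definition return_set (Y : Type) (R : realType) (F : R -> Y -> Y)
    (delta s : R) (A : set Y) : set Y :=
  [set y | A y /\ exists2 t,
    (`]expR (s - delta), expR (s + delta)[ `|`
     `]- expR (s + delta), - expR (s - delta)[) t & A (F t y)].

(* [return_set] is an uncountable union, hence an analytic set that need not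
   be measurable but is so for the completion of [nu]; [mu_ext nu], the outer
   measure induced by [nu], agrees with the completion there. *)
Definition property_B d (Y : measurableType d) (R : realType)
    (nu : set Y -> \bar R) (F : R -> Y -> Y) : Prop :=
  exists A : set Y, [/\ measurable A, (0 < nu A)%E &
    forall delta : R, 0 < delta ->
      limf_esup (fun s : R => mu_ext nu (return_set F delta s A)) +oo = 0%E].

Definition under_graph (Z : Type) (R : realType) (xi : Z -> R) :
    set (Z * R) :=
  [set p | 0 <= p.2 < xi p.1].

(* [q] is reached from [p] by moving upward for time [t >= 0], crossing [n]
   times from [(z, xi z)] to [(T z, 0)]. *)
Definition moves_up (Z : Type) (R : realType) (T : Z -> Z) (xi : Z -> R)
    (t : R) (p q : Z * R) : Prop :=
  [/\ under_graph xi p, under_graph xi q &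
      exists n, q.1 = iter n T p.1 /\
        q.2 = p.2 + t - \sum_(k < n) xi (iter k T p.1)].

(* The graph of the time [t] map of the flow built under [xi] over [T]. *)
Definition flow_under (Z : Type) (R : realType) (T : Z -> Z) (xi : Z -> R)
    (t : R) (p q : Z * R) : Prop :=
  if 0 <= t then moves_up T xi t p q else moves_up T xi (- t) q p.

Definition under_measure d (Z : measurableType d) (R : realType)
    (mu0 : set Z -> \bar R) (xi : Z -> R) (B : set (Z * R)) : \bar R :=
  (mu0 \x @lebesgue_measure R)%E (B `&` under_graph xi).

Definition lacunary (X : Type) (R : realType) (E : set (X * X))
    (delta : X * X -> R) : Prop :=
  exists2 e : R, 0 < e & forall p, E p ->
    ln (delta p) = 0 \/ e < `|ln (delta p)|.

Definition log_jumps (X : Type) (R : realType) (E : set (X * X))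
    (delta : X * X -> R) (x : X) : set R :=
  [set l | 0 < l /\ exists2 x', E (x', x) & l = ln (delta (x', x))].

Definition is_min (R : realType) (A : set R) (a : R) : Prop :=
  A a /\ lbound A a.

Definition unit_subrelation (X : Type) (R : realType) (E : set (X * X))
    (delta : X * X -> R) : set (X * X) :=
  [set p | E p /\ delta p = 1].

(* [pi] realizes the quotient of [(X, mu)] by the sigma-algebra of
   [E]-invariant sets: modulo null sets, that sigma-algebra is the preimage
   under [pi] of the one of [Z]. *)
Record invariant_quotient d dZ (X : measurableType d) (Z : measurableType dZ)
    (R : realType) (mu : set X -> \bar R) (E : set (X * X)) (pi : X -> Z) :
    Prop := InvariantQuotient {
  quotient_standard : standard_borel R Z ;
  quotient_measurable : measurable_fun [set: X] pi ;
  quotient_invariant : forall B, measurable B ->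
    exists A, [/\ measurable A, invariant_set E A &
                  {ae mu, forall x, A x <-> B (pi x)}] ;
  quotient_full : forall A, measurable A -> invariant_set E A ->
    exists2 B, measurable B & {ae mu, forall x, A x <-> B (pi x)} }.

(* [F] is conjugate to the flow built under [xi] over [T], where [m] is a
   lacunary measure equivalent to [mu] and [xi], [T], [pi] are constructed
   from it.  The pushforward of [m] need not be sigma-finite, but conjugacy
   only involves null sets. *)
Definition associated_flow d dY (X : measurableType d) (Y : measurableType dY)
    (R : realType) (mu : set X -> \bar R) (E : set (X * X))
    (nu : set Y -> \bar R) (F : R -> Y -> Y) : Prop :=
  exists (m : {sigma_finite_measure set X -> \bar R}) (delta : X * X -> R)
    (dZ : measure_display) (Z : measurableType dZ) (pi : X -> Z)
    (xi : Z -> R) (T : Z -> Z) (Psi : Y -> Z * R),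
  let mu0 := pushforward m pi in
  [/\ equivalent_measures m mu, RN_cocycle m E delta & lacunary E delta] /\
  [/\ invariant_quotient m (unit_subrelation E delta) pi,
      measurable_fun [set: Z] xi,
      {ae m, forall x, is_min (log_jumps E delta x) (xi (pi x))},
      nonsingular_aut mu0 T &
      {ae m, forall x, forall x', E (x, x') ->
        ln (delta (x', x)) = xi (pi x) -> T (pi x) = pi x'}] /\
  [/\ iso_mod0 nu (under_measure mu0 xi) Psi &
      forall t, {ae nu, forall y, flow_under T xi t (Psi y) (Psi (F t y))}].

Definition orbit_equivalent d d' (X : measurableType d)
    (X' : measurableType d') (R : realType) (mu : set X -> \bar R)
    (E : set (X * X)) (mu' : set X' -> \bar R) (E' : set (X' * X')) : Prop :=
  exists2 S : X -> X', iso_mod0 mu mu' S &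
    {ae mu, forall x, S @` eqv_class E x = eqv_class E' (S x)}.

(* The [n]-th factor has [k n + 2] points. *)
Definition sequences (k : nat -> nat) : Type := forall n, 'I_(k n).+2.

HB.instance Definition _ k := gen_eqMixin (sequences k).
HB.instance Definition _ k := gen_choiceMixin (sequences k).
HB.instance Definition _ k := isPointed.Build (sequences k) (fun=> ord0).

Definition cylinder k (a : sequences k) (n : nat) : set (sequences k) :=
  [set x | forall i, (i < n)%N -> x i = a i].

Definition cylinders k : set (set (sequences k)) :=
  [set C | exists a n, C = cylinder a n].

Notation product_space k := (g_sigma_algebraType (@cylinders k)).

Definition tail_eqv k : set (product_space k * product_space k) :=
  [set p | exists n, forall i, (n <= i)%N -> p.1 i = p.2 i].

(* A probability measure on [product_space k] is the product of the [mu_n]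
   iff it has the product values on cylinders. *)
Definition product_type d (X : measurableType d) (R : realType)
    (mu : set X -> \bar R) (E : set (X * X)) : Prop :=
  exists (k : nat -> nat) (p : forall n, 'I_(k n).+2 -> R)
    (P : probability (product_space k) R),
  [/\ forall n i, 0 < p n i,
      forall n, \sum_(i < (k n).+2) p n i = 1,
      forall a n, P (cylinder a n) = (\prod_(i < n) p i (a i))%:E &
      orbit_equivalent mu E P (@tail_eqv k)].

(* Main.v *)
Require Import Defs.
From HB Require Import structures.
From mathcomp Require Import all_boot all_order all_algebra.
From mathcomp Require Import all_classical all_reals all_analysis.
From mathcomp Require Import measurable_realfun lra.
Set Implicit Arguments.
Unset Strict Implicit.
Unset Printing Implicit Defensive.
Import Order.TTheory GRing.Theory Num.Theory.
Import numFieldNormedType.Exports.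
Local Open Scope classical_set_scope.
Local Open Scope ring_scope.

(** Let [S] be an orbit equivalence onto the tail relation of a product measure
    [P].  It changes the logarithm of the Radon-Nikodym cocycle by a coboundary,
    hence by a bounded amount on some subset of positive measure of any given
    set of positive measure ([bounded_transfer]).  On such a set, two recurrence
    properties contradict each other.

    On the one hand, the associated flow moves a point of the fiber over [pi x]
    to the fiber over [pi x'] in the time [ln (delta (x', x))], up to the
    heights of the points, which are bounded on the part of a set below a fixed
    level.  Property B therefore gives a set of positive measure in [X] such that,
    for every sequence of scales [s j] that grows fast enough, almost every
    [x] in the set has only finitely many [j] for which [|ln (delta (x', x))|] is
    comparable with [expR (s j)] for some equivalent [x'] in the set
    ([property_B_base]).

    On the other hand, for every set [B] of positive measure and every choice of
    lower bounds for the [s j], the [s j] can be chosen such that a set of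
    positive measure of points of [B] find, for infinitely many [j], a tail
    equivalent point of [B] at log-distance comparable with [expR (s j)]
    ([recurrent_scales]); this is Krieger's Property A.  Indeed the log-weights
    are sums of independent variables.  As [0] is an asymptotic ratio, the cocycle
    is unbounded on every set of positive measure ([ratio0_unbounded]), so by
    Ottaviani's maximal inequality the partial sums are not concentrated on
    intervals of bounded length ([not_concentrated]).  A variable which is not
    concentrated has many values from which it is at a comparable large distance
    with a probability bounded below ([two_scales]).  Inside a cylinder almost
    filled by [B] ([density]), replacing a long block of coordinates by that of a
    suitable point realizes such a distance and keeps most points in [B]. *)

(** * Measures and probabilities *)

Lemma mpreimage d1 d2 (T1 : measurableType d1) (T2 : measurableType d2)
    (f : T1 -> T2) (B : set T2) :
  measurable_fun [set: T1] f -> measurable B -> measurable (f @^-1` B).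
Proof. by move=> mf mB; rewrite -[X in measurable X]setTI; exact: mf. Qed.

(** Packs a push-forward as a measure without exposing the measurability proof. *)
Lemma pushforward_measure d d' (T1 : measurableType d) (T2 : measurableType d')
    (R : realType) (m : {measure set T1 -> \bar R}) (f : T1 -> T2) :
    measurable_fun [set: T1] f ->
  exists m' : {measure set T2 -> \bar R}, forall A, m' A = m (f @^-1` A).
Proof.
by move=> mf; unshelve (eexists (pushforward m f : {measure set T2 -> \bar R})).
Qed.

Section prob.
Context d (T : measurableType d) (R : realType) (P : probability T R).

Definition prob (A : set T) : R := fine (P A).

Lemma probE A : measurable A -> P A = (prob A)%:E.
Proof. by move=> mA; rewrite /prob fineK// fin_num_measure. Qed.

Lemma prob_ge0 A : measurable A -> 0 <= prob A.
Proof. by move=> mA; rewrite -lee_fin -probE. Qed.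

Lemma le_prob A B : measurable A -> measurable B -> A `<=` B ->
  prob A <= prob B.
Proof. by move=> mA mB AB; rewrite -lee_fin -!probE// le_measure ?inE. Qed.

Lemma probC A : measurable A -> prob (~` A) = 1 - prob A.
Proof.
move=> mA; apply: EFin_inj; rewrite -probE; last exact: measurableC.
by rewrite probability_setC// probE.
Qed.

Lemma probT : prob setT = 1.
Proof. by rewrite /prob probability_setT. Qed.

Lemma probU A B : measurable A -> measurable B ->
  prob (A `|` B) <= prob A + prob B.
Proof.
move=> mA mB; rewrite -lee_fin EFinD -!probE//; last exact: measurableU.
exact: measureU2.
Qed.

Lemma probD A B : measurable A -> measurable B ->
  prob A - prob B <= prob (A `\` B).
Proof.
move=> mA mB; rewrite lerBlDr.
apply: le_trans (probU (measurableD mA mB) mB).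
apply: le_prob => //; first by apply: measurableU => //; exact: measurableD.
by move=> x Ax; case: (pselect (B x)) => Bx; [right|left].
Qed.

Lemma prob_gt0 A : measurable A -> (0 < P A)%E = (0 < prob A).
Proof. by move=> mA; rewrite probE// lte_fin. Qed.

End prob.

(** * Product spaces *)

Section product.
Context (k : nat -> nat).
Local Notation Om := (product_space k).
Implicit Types (a x y : sequences k) (n m : nat).

Definition agree n x y := forall i, (i < n)%N -> x i = y i.

Definition determined n (A : set (sequences k)) :=
  forall x y, agree n x y -> A x -> A y.

(** Prefixes are coded by lists of numbers, of which there are countably many. *)
Definition decode (l : seq nat) : sequences k := fun i => inord (nth 0%N l i).

Lemma decode_agree n x : exists l, agree n x (decode l).
Proof.
exists (mkseq (fun i => nat_of_ord (x i)) n) => i ni.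
by apply: val_inj; rewrite /= /decode nth_mkseq// inordK.
Qed.

Lemma measurable_cylinder n a : measurable (cylinder a n : set Om).
Proof. by apply: sub_sigma_algebra; exists a, n. Qed.

(** Such a set is a countable union of cylinders. *)
Lemma determined_measurable n (A : set Om) : determined n A -> measurable A.
Proof.
move=> dA.
have -> : A = \bigcup_(l : seq nat)
    (if `[<A (decode l)>] then cylinder (decode l) n else set0).
  apply/seteqP; split => x.
    move=> Ax; have [l xl] := decode_agree n x.
    by exists l => //; case: asboolP => // -[]; exact: dA xl Ax.
  move=> [l _]; case: asboolP => // Al xl.
  by apply: dA Al => i ni; rewrite xl.
apply: countable_bigcupT_measurable => // l.
by case: ifP => _ //; exact: measurable_cylinder.
Qed.

(** The equation [n = i] transports [v] to the type of the coordinate [i]. *)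
Definition upd a n (v : 'I_(k n).+2) : sequences k := fun i =>
  match eqVneq n i with
  | EqNotNeq e => ecast i ('I_(k i).+2) e v
  | _ => a i
  end.
Arguments upd : clear implicits.

Lemma upd_same a n v : upd a n v n = v :> 'I_(k n).+2.
Proof.
rewrite /upd; case: eqVneq => [e|/eqP//].
by rewrite (eq_irrelevance e erefl).
Qed.

Lemma upd_other a n v i : n != i -> upd a n v i = a i :> 'I_(k i).+2.
Proof. by rewrite /upd; case: eqVneq. Qed.

Definition merge n x y : sequences k := fun i => if (i < n)%N then x i else y i.

Lemma merge_lt n x y i : (i < n)%N -> merge n x y i = x i.
Proof. by rewrite /merge => ->. Qed.

Lemma merge_ge n x y i : (n <= i)%N -> merge n x y i = y i.
Proof. by rewrite /merge ltnNge => ->. Qed.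

Lemma measurable_merge n :
  measurable_fun [set: Om * Om] (fun q => merge n q.1 q.2 : Om).
Proof.
apply: (@measurability _ _ (Om * Om)%type Om setT _ (@cylinders k)) => // _ [_ [a [m ->]] <-].
rewrite setTI.
pose U : set Om := [set x | forall i, (i < m)%N -> (i < n)%N -> x i = a i].
pose V : set Om := [set y | forall i, (i < m)%N -> (n <= i)%N -> y i = a i].
have -> : (fun q : Om * Om => merge n q.1 q.2 : Om) @^-1` cylinder a m
    = U `*` V.
  apply/seteqP; split => [[x y] h|[x y] [/= h1 h2]].
    split => /= i im.
      by move=> ni; rewrite -(h i im) /= merge_lt.
    by move=> ni; rewrite -(h i im) /= merge_ge.
  move=> i im /=; case: (ltnP i n) => ni.
    by rewrite merge_lt// h1.
  by rewrite merge_ge// h2.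
apply: measurableX; apply: (@determined_measurable m) => x y xy h i im ni.
  by rewrite -xy// h.
by rewrite -xy// h.
Qed.

Lemma measurable_merge1 n x : measurable_fun [set: Om] (merge n x : Om -> Om).
Proof.
have -> : (merge n x : Om -> Om) =
    (fun q : Om * Om => merge n q.1 q.2 : Om) \o (fun y => (x, y)).
  by [].
apply: measurableT_comp; first exact: measurable_merge.
exact: pair1_measurable.
Qed.

Lemma measurable_merge_pre n x (B : set Om) : measurable B ->
  measurable ([set y | B (merge n x y)] : set Om).
Proof.
move=> mB; rewrite -[X in measurable X]setTI.
exact: (measurable_merge1 n x).
Qed.

End product.
Arguments upd {k} a n v.

(** * Product measures *)

Section product_prob.
Context (R : realType) (k : nat -> nat) (p : forall n, 'I_(k n).+2 -> R).
Local Notation Om := (product_space k).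
Context (P : probability Om R).
Hypothesis p_sum1 : forall n, \sum_(i < (k n).+2) p (n:=n) i = 1.
Hypothesis P_cyl : forall a n, P (cylinder a n) = (\prod_(i < n) p (a i))%:E.
Implicit Types (a x y : sequences k) (n m : nat).

(** The coordinates before the window are summed out one at a time. *)
Lemma P_window n m a : (n <= m)%N ->
  P ([set y : sequences k | forall i, (n <= i < m)%N -> y i = a i] : set Om)
  = (\prod_(n <= i < m) p (a i))%:E.
Proof.
elim: n a => [|n IH] a nm.
  rewrite (_ : [set y | _] = cylinder a m).
    by rewrite P_cyl big_mkord.
  by apply/seteqP; split => x h i im; apply: h.
have -> : [set y : sequences k | forall i, (n < i < m)%N -> y i = a i] =
    \big[setU/set0]_(v < (k n).+2)
       [set y : sequences k | forall i, (n <= i < m)%N -> y i = upd a n v i].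
  rewrite -bigcup_mkord_ord /=; apply/seteqP; split => [y h|y].
    exists (nat_of_ord (y n)); first exact: ltn_ord.
    rewrite inord_val => i /andP[]; rewrite leq_eqVlt => /orP[/eqP <-|ni im].
      by rewrite upd_same.
    by rewrite upd_other ?h ?ni ?im// neq_ltn ni.
  move=> [v _ h] i /andP[ni im].
  by rewrite h ?im ?(ltnW ni)// upd_other// neq_ltn ni.
rewrite (@measure_bigsetU_ord _ _ _ P _ xpredT); last 2 first.
- move=> v; apply: (@determined_measurable _ m) => x y xy h i /andP[ni im].
  by rewrite -xy// h// ni im.
- apply/trivIsetP => v w _ _ vw; apply/seteqP; split => // y [h1 h2].
  have nn : (n <= n < m)%N by rewrite leqnn.
  move: (h1 n nn); rewrite (h2 n nn) !upd_same => e.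
  by move: vw; rewrite e eqxx.
rewrite (eq_bigr (fun v : 'I_(k n).+2 =>
    (p v * \prod_(n.+1 <= i < m) p (a i))%:E)); last first.
  move=> v _; rewrite [LHS](IH (upd a n v) (ltnW nm)) big_ltn// upd_same; congr (_ * _)%:E.
  apply: eq_big_nat => i /andP[ni _].
  by rewrite upd_other// neq_ltn ni.
by rewrite sumEFin -mulr_suml p_sum1 mul1r.
Qed.

(** If [x] and [y] are independent with law [P], then [merge n x y] has law [P]:
    it is enough to compare the values on cylinders, which pull back to
    rectangles.  The empty set is added to the cylinders to make them stable
    under intersection. *)
Lemma P_merge n (B : set Om) : measurable B ->
  P B = (\int[P]_x P [set y | B (merge n x y)])%E.
Proof.
move=> mB.
pose f (q : Om * Om) : Om := merge n q.1 q.2.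
have mf : measurable_fun [set: Om * Om] f := @measurable_merge k n.
transitivity (pushforward (P \x P)%E f B); last first.
  rewrite /pushforward /product_measure1; apply: eq_integral => x _ /=.
  by rewrite xsectionE.
have [PP PPE] := pushforward_measure (P \x P)%E mf.
rewrite /pushforward -PPE.
pose G := @cylinders k `|` [set set0].
have sG : <<s G >> = <<s @cylinders k >>.
  apply/seteqP; split; last first.
    apply: smallest_sub; first exact: smallest_sigma_algebra.
    by move=> A CA; apply: sub_sigma_algebra; left.
  apply: smallest_sub; first exact: smallest_sigma_algebra.
  move=> A [|->]; first exact: sub_sigma_algebra.
  exact: (@measurable0 _ Om).
have mG : @measurable _ Om = <<s G >> by rewrite sG.
apply: (@measure_unique _ R Om G (fun=> setT) mG _ _ _ P PP _ _ B mB) => //.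
- move=> A C [[a [n1 ->]]|->]; last by rewrite set0I => _; right.
  move=> [[b [n2 ->]]|->]; last by rewrite setI0; right.
  case: (pselect (cylinder a n1 `&` cylinder b n2 = set0)) => [->|/eqP/set0P].
    by right.
  move=> [c [ca cb]]; left; exists c, (maxn n1 n2); apply/seteqP; split => z.
    move=> [za zb] i; rewrite leq_max => /orP[] h.
      by rewrite za// ca.
    by rewrite zb// cb.
  move=> zc; split => i h; rewrite zc ?leq_max ?h ?orbT//.
    by rewrite ca.
  by rewrite cb.
- move=> _; left; exists (fun=> ord0), 0%N.
  by apply/seteqP; split => // x _ i.
- by apply/seteqP; split => // x _; exists 0%N.
- move=> A [[a [m ->]]|->]; last by rewrite measure0 [RHS]measure0.
  rewrite [LHS]P_cyl PPE.
  pose U : set Om := cylinder a (minn n m).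
  pose V : set Om := [set y | forall i, (minn n m <= i < m)%N -> y i = a i].
  have -> : f @^-1` cylinder a m = U `*` V.
    apply/seteqP; split => [[x y] h|[x y] [/= h1 h2]].
      split => /= i.
        by rewrite leq_min => /andP[ni im]; rewrite -(h i im) /= /f merge_lt.
      rewrite geq_min => /andP[] /orP[ni|mi] im; last first.
        by move: (leq_ltn_trans mi im); rewrite ltnn.
      by rewrite -(h i im) /= /f merge_ge.
    move=> i im /=; rewrite /f; case: (ltnP i n) => ni.
      by rewrite merge_lt//= h1// leq_min ni.
    by rewrite merge_ge//= h2// geq_min ni.
  rewrite [RHS]product_measure1E//; last 2 first.
  - exact: measurable_cylinder.
  - apply: (@determined_measurable _ m) => x y xy h i /andP[ni im].
    by rewrite -xy// h// ni im.
  rewrite [X in _ = (X * _)%E](P_cyl a (minn n m)).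
  rewrite [X in _ = (_ * X)%E](P_window a (geq_minr n m)) -EFinM.
  rewrite -(big_mkord xpredT (fun i => p (a i))).
  rewrite -(big_mkord xpredT (fun i => p (a i))).
  by rewrite -big_cat_nat ?geq_minr.
- by move=> _; rewrite [ltLHS](probability_setT P) ltry.
Qed.

End product_prob.

(** * Approximation by cylinders *)

Section prob_limits.
Context d (T : measurableType d) (R : realType) (P : probability T R).

(** The tail unions decrease to the upper limit, and each contains some [K n]. *)
Lemma prob_limsup (K : (set T)^nat) (e : R) : (forall n, measurable (K n)) ->
  (forall n, e <= prob P (K n)) -> e <= prob P (lim_sup_set K).
Proof.
move=> mK eK.
have mU n : measurable (\bigcup_(j >= n) K j) by exact: bigcup_measurable.
have mL : measurable (lim_sup_set K) by exact: bigcapT_measurable.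
rewrite -lee_fin -probE//.
have fin : (P (\bigcup_(j >= 0) K j) < +oo)%E.
  by rewrite (le_lt_trans (probability_le1 P (mU 0%N)))// ltry.
have cvgK := lim_sup_set_cvg P K mK fin.
rewrite -(cvg_lim _ cvgK)//; apply: lime_ge; first by apply/cvg_ex; eexists; exact: cvgK.
apply: nearW => n.
apply: (@le_trans _ _ (P (K n))); first by rewrite probE// lee_fin.
by rewrite le_measure ?inE// => x Kx; exists n => //=.
Qed.

Lemma prob_bigcup_approx (B : (set T)^nat) (e : R) :
  (forall n, measurable (B n)) -> 0 < e ->
  exists n, prob P (\bigcup_i B i `\` \big[setU/set0]_(i < n) B i) <= e.
Proof.
move=> mB e0.
pose U n := \big[setU/set0]_(i < n) B i.
have mU n : measurable (U n) by exact: bigsetU_measurable.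
have mBU : measurable (\bigcup_i B i) by exact: bigcupT_measurable.
pose D n := \bigcup_i B i `\` U n.
have mD n : measurable (D n) by exact: measurableD.
have D0 : \bigcap_n D n = set0.
  apply/seteqP; split => // x Dx.
  have [[i _ Bix] _] := Dx 0%N I.
  have [_] := Dx i.+1 I; apply.
  by rewrite /U big_ord_recr; right.
have cvgD : P (D n) @[n --> \oo] --> P set0.
  rewrite -D0; apply: nonincreasing_cvg_mu => //.
  - by rewrite (le_lt_trans (probability_le1 P _))// ltry.
  - by rewrite D0.
  - move=> m n mn; apply/subsetPset; apply: setDS.
    exact: subset_bigsetU.
rewrite measure0 in cvgD.
have /fine_cvgP[_ /cvgrPdist_lt /(_ e e0)[n _ /(_ n (leqnn n))]] := cvgD.
by rewrite /= sub0r normrN => /ltr_normlW/ltW De; exists n.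
Qed.

End prob_limits.

Section approx.
Context (R : realType) (k : nat -> nat).
Local Notation Om := (product_space k).
Context (P : probability Om R).

Definition symdiff (A B : set Om) := (A `\` B) `|` (B `\` A).

Definition approximable (B : set Om) := measurable B /\
  forall e : R, 0 < e ->
    exists n (A : set Om), determined n A /\ prob P (symdiff B A) <= e.

Lemma measurable_symdiff (A B : set Om) : measurable A -> measurable B ->
  measurable (symdiff A B).
Proof. by move=> mA mB; apply: measurableU; exact: measurableD. Qed.

Lemma symdiffC (A B : set Om) : symdiff (~` A) (~` B) = symdiff A B.
Proof.
rewrite /symdiff; apply/seteqP; split => x /=.
  by move=> [[nA /contrapT Bx]|[nB /contrapT Ax]]; [right|left].
by move=> [[Ax nB]|[Bx nA]]; [right|left]; split => //; exact.
Qed.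

Lemma approximableU A B : approximable A -> approximable B ->
  approximable (A `|` B).
Proof.
move=> [mA hA] [mB hB]; split; first exact: measurableU.
move=> e e0; have e2 : 0 < e / 2 by lra.
have [n [A' [dA' pA']]] := hA _ e2; have [m [B' [dB' pB']]] := hB _ e2.
have mA' := determined_measurable dA'.
have mB' := determined_measurable dB'.
exists (maxn n m), (A' `|` B'); split.
  move=> x y xy [A'x|B'x]; [left; apply: dA' A'x|right; apply: dB' B'x].
    by move=> i ni; apply: xy; rewrite leq_max ni.
  by move=> i ni; apply: xy; rewrite leq_max ni orbT.
apply: (@le_trans _ _ (prob P (symdiff A A' `|` symdiff B B'))).
  apply: le_prob.
  - by apply: measurable_symdiff; exact: measurableU.
  - by apply: measurableU; exact: measurable_symdiff.
  - rewrite /symdiff => x /= [[[Ax|Bx] /not_orP[nA nB]]|[[A'x|B'x] /not_orP[nA nB]]].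
    + by left; left.
    + by right; left.
    + by left; right.
    + by right; right.
apply: le_trans (probU _ _ _) _; [exact: measurable_symdiff..|].
by lra.
Qed.

Lemma approximable0 : approximable set0.
Proof.
split => // e e0; exists 0%N, set0; split => //.
by rewrite /symdiff set0D setU0 /prob measure0 ltW.
Qed.

Lemma approximable_bigcup (F : (set Om)^nat) :
  (forall i, approximable (F i)) -> approximable (\bigcup_i F i).
Proof.
move=> hF.
have mF i : measurable (F i : set Om) by case: (hF i).
split; first exact: bigcupT_measurable.
move=> e e0; have e2 : 0 < e / 2 by lra.
have [n Fn] := prob_bigcup_approx P mF e2.
have hU : approximable (\big[setU/set0]_(i < n) F i).
  by elim/big_ind : _ => //; [exact: approximable0|exact: approximableU].
move: hU Fn; set U := (\big[_/_]_(_ < _) _) => -[mU hU] Fn.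
have [m [A [dA pA]]] := hU _ e2.
have mA := determined_measurable dA.
have UF : U `<=` \bigcup_i F i by exact: bigsetU_bigcup.
have mUF : measurable (\bigcup_i F i) by exact: bigcupT_measurable.
exists m, A; split => //.
apply: (@le_trans _ _ (prob P ((\bigcup_i F i `\` U) `|` symdiff U A))).
  apply: le_prob.
  + exact: measurable_symdiff.
  + apply: measurableU; first exact: measurableD.
    exact: measurable_symdiff.
  + move=> x [[Fx nA]|[Ax nF]].
      case: (pselect (U x)) => Ux; last by left.
      by right; left.
    by right; right; split => // /UF.
apply: le_trans (probU _ _ _) _.
+ exact: measurableD.
+ exact: measurable_symdiff.
+ by lra.
Qed.

(** The approximable sets form a sigma-algebra that contains the cylinders. *)
Lemma measurable_approximable (B : set Om) : measurable B -> approximable B.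
Proof.
suff : <<s @cylinders k >> `<=` approximable by exact.
apply: smallest_sub; last first.
  move=> _ [a [n ->]]; split; first exact: measurable_cylinder.
  move=> e e0; exists n, (cylinder a n); split; last first.
    by rewrite /symdiff setDv setU0 /prob measure0 ltW.
  by move=> x y xy xa i ni; rewrite -xy// xa.
split.
- exact: approximable0.
- move=> A [mA hA]; rewrite setTD; split; first exact: measurableC.
  move=> e e0; have [n [A' [dA' pA']]] := hA _ e0.
  exists n, (~` A'); split; last by rewrite symdiffC.
  move=> x y xy nA'x A'y; apply: nA'x; apply: dA' A'y => i ni.
  by rewrite xy.
- exact: approximable_bigcup.
Qed.

End approx.

(** * Lebesgue density and independence *)

Section fibers.
Context (R : realType) (k : nat -> nat) (p : forall n, 'I_(k n).+2 -> R).
Local Notation Om := (product_space k).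
Context (P : probability Om R).
Hypothesis p_sum1 : forall n, \sum_(i < (k n).+2) p (n:=n) i = 1.
Hypothesis P_cyl : forall a n, P (cylinder a n) = (\prod_(i < n) p (a i))%:E.
Implicit Types (a x y : sequences k) (n m : nat).

(** The set [B] seen from the cylinder of [x] of length [n]: its probability is
    the conditional probability of [B] in that cylinder. *)
Definition fiber n x (B : set Om) : set Om := [set y | B (merge n x y)].

Lemma measurable_fiber n x B : measurable B -> measurable (fiber n x B).
Proof. exact: measurable_merge_pre. Qed.

Lemma measurable_fun_fiber n B : measurable B ->
  measurable_fun [set: Om] ((fun x => P (fiber n x B)) : Om -> \bar R).
Proof.
move=> mB.
have mA : measurable ((fun q : Om * Om => merge n q.1 q.2 : Om) @^-1` B).
  by rewrite -[X in measurable X]setTI; exact: (@measurable_merge k n).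
have := measurable_fun_xsection P mA.
by apply: eq_measurable_fun => x _ /=; rewrite xsectionE.
Qed.

(** Otherwise the fibers over [G] alone would give [B] too much mass. *)
Lemma small_fiber n (G B : set Om) (c : R) : measurable G -> measurable B ->
  0 <= c -> prob P B < c * prob P G ->
  exists2 w, G w & prob P (fiber n w B) < c.
Proof.
move=> mG mB c0 BG; apply: contrapT => h.
have hc w : G w -> c <= prob P (fiber n w B).
  by move=> Gw; rewrite leNgt; apply/negP => wc; apply: h; exists w.
move: BG; rewrite ltNge => /negP; apply.
rewrite -lee_fin EFinM -!probE// (P_merge p_sum1 P_cyl n mB).
apply: (@le_trans _ _ (\int[P]_(x in G) P (fiber n x B))%E); last first.
  apply: ge0_subset_integral => //; exact: measurable_fun_fiber.
rewrite -integral_cst//; apply: ge0_le_integral => //.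
- exact: measurable_funS (measurable_fun_fiber n mB).
- move=> x Gx; rewrite probE; last exact: measurable_fiber.
  by rewrite lee_fin hc.
Qed.

(** Lebesgue density along cylinders: a set [A] that depends on [n] coordinates
    and approximates [B] meets the complement of [B] in a small set, so some
    point of [A] has a fiber where that complement is small. *)
Lemma density (B : set Om) (b : R) : measurable B -> 0 < prob P B ->
  0 < b <= 1 -> exists n x, prob P (~` fiber n x B) < b.
Proof.
move=> mB B0 /andP[b0 b1].
have e0 : 0 < b * prob P B / 3 by rewrite divr_gt0// mulr_gt0.
have [_ /(_ _ e0)[n [A [dA pA]]]] := measurable_approximable P mB.
have mA := determined_measurable dA.
have mS := measurable_symdiff mB mA.
have hBA : prob P B <= prob P A + prob P (symdiff B A).
  apply: le_trans (probU _ mA mS).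
  apply: le_prob => //; first exact: measurableU.
  move=> x Bx; case: (pselect (A x)) => Ax; first by left.
  by right; left.
have hAB : prob P (A `&` ~` B) <= prob P (symdiff B A).
  apply: le_prob => //.
    by apply: measurableI => //; exact: measurableC.
  by move=> x [Ax nB]; right.
have bB : b * prob P B <= prob P B by rewrite ler_piMl// ltW.
have h : prob P (A `&` ~` B) < b * prob P A.
  apply: (@lt_le_trans _ _ (b * (prob P B * (2/3)))); last first.
    by rewrite ler_pM2l//; lra.
  by apply: le_lt_trans hAB _; apply: le_lt_trans pA _; rewrite mulrA; nra.
have mAB : measurable (A `&` ~` B).
  by apply: measurableI => //; exact: measurableC.
have [w Aw hw] := small_fiber n mA mAB (ltW b0) h.
exists n, w; apply: le_lt_trans hw.
apply: le_prob.
- by apply: measurableC; exact: measurable_fiber.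
- apply: measurable_fiber; apply: measurableI => //; exact: measurableC.
- move=> y nB; split => //; apply: dA Aw => i ni.
  by rewrite merge_lt.
Qed.

(** In [merge n x y] the set [F] only sees [x] and the set [G] only sees [y]. *)
Lemma independent n (F G : set Om) : measurable G -> determined n F ->
  (forall x y, (forall i, (n <= i)%N -> x i = y i) -> G x -> G y) ->
  prob P (F `&` G) = prob P F * prob P G.
Proof.
move=> mG dF dG; have mF := determined_measurable dF.
have mFG : measurable (F `&` G) by exact: measurableI.
apply: EFin_inj; rewrite EFinM -!probE// (P_merge p_sum1 P_cyl n mFG).
rewrite (eq_integral (fun x : Om => (\1_F x)%:E * P G)%E); last first.
  move=> x _; rewrite indicE; case: (boolP (x \in F)) => [|/negP] /[!inE] Fx.
    rewrite mul1e; congr (P _); apply/seteqP; split => y.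
      by move=> [_]; apply: dG => i ni; rewrite merge_ge.
    move=> Gy; split; first by apply: dF Fx => i ni; rewrite merge_lt.
    by apply: dG Gy => i ni; rewrite merge_ge.
  rewrite mul0e -[RHS](measure0 P); congr (P _); apply/seteqP; split => // y.
  by move=> [Fy _]; apply: Fx; apply: dF Fy => i ni; rewrite merge_lt.
rewrite ge0_integralZr//.
  by rewrite integral_indic// setIT.
by apply: measurableT_comp => //; exact: measurable_indic.
Qed.

End fibers.

(** * Scales of a real random variable *)

Section prob_sums.
Context d (T : measurableType d) (R : realType) (P : probability T R).

Lemma prob_sum_le (E : (set T)^nat) (B : set T) m :
  (forall i, measurable (E i)) -> measurable B -> trivIset setT E ->
  (forall i, E i `<=` B) -> \sum_(i < m) prob P (E i) <= prob P B.
Proof.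
move=> mE mB tE EB.
have mU : measurable (\big[setU/set0]_(i < m) E i).
  by apply: bigsetU_measurable.
rewrite -lee_fin -probE// -sumEFin.
under eq_bigr do rewrite -probE//.
rewrite -(measure_semi_additive_ord_I P)//.
  rewrite le_measure ?inE// -bigcup_mkord => x [i _ Eix].
  exact: EB Eix.
exact: sub_trivIset tE.
Qed.

Lemma prob_union_le (E : (set T)^nat) m : (forall i, measurable (E i)) ->
  prob P (\big[setU/set0]_(i < m) E i) <= \sum_(i < m) prob P (E i).
Proof.
move=> mE; elim: m => [|m IH].
  by rewrite !big_ord0 /prob measure0.
rewrite !big_ord_recr /=; apply: le_trans (probU _ _ _) _ => //.
  exact: bigsetU_measurable.
by rewrite lerD2r.
Qed.

(** A quantile up to the mesh [r] of a grid: the last point of the grid below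
    which [f] lies with probability at most [e]. *)
Lemma grid_quantile (f : T -> R) (K r e : R) :
  (forall Q : set R, measurable (f @^-1` Q)) -> (forall x, `|f x| <= K) ->
  0 < r -> 0 <= e < 1 ->
  exists a, prob P (f @^-1` [set t | t < a]) <= e /\
            e < prob P (f @^-1` [set t | t < a + r]).
Proof.
move=> mf fK r0 /andP[e0 e1].
pose Q j := prob P (f @^-1` [set t | t < - K + j%:R * r]) <= e.
have Q0 : exists j, Q j.
  exists 0%N; rewrite /Q mul0r addr0 (_ : _ @^-1` _ = set0).
    by rewrite /prob measure0.
  apply/seteqP; split => // x /=; have := fK x; rewrite ler_norml.
  by move=> /andP[Kf _]; rewrite ltNge Kf.
pose b := Num.bound ((K + K) / r).
have Qb j : Q j -> (j <= b)%N.
  move=> Qj; rewrite leqNgt; apply/negP => bj; move: Qj; apply/negP.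
  rewrite -ltNge (_ : _ @^-1` _ = setT) ?probT//.
  apply/seteqP; split => // x _ /=.
  have K0 : 0 <= K by apply: le_trans (fK x).
  have q0 : 0 <= (K + K) / r by apply: divr_ge0; lra.
  have : (K + K) / r < j%:R.
    by apply: lt_trans (archi_boundP q0) _; rewrite ltr_nat.
  rewrite ltr_pdivrMr// => h; have := fK x; rewrite ler_norml => /andP[_ h2].
  by lra.
case: (ex_maxnP Q0 Qb) => j Qj jmax.
exists (- K + j%:R * r); split => //.
rewrite ltNge; apply/negP => h.
have : Q j.+1 by rewrite /Q -natr1 mulrDl mul1r addrA.
by move=> /jmax; rewrite ltnn.
Qed.

(** A variable which is not concentrated on a short interval has at many of
    its values [f w] a scale [sigma w] such that [f x] is, with a probability
    bounded below, at distance comparable with [sigma w] from [f w]: far values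
    are compared with the central part, and otherwise the two extreme
    parts with each other. *)
Lemma two_scales (f : T -> R) (K r : R) :
  (forall Q : set R, measurable (f @^-1` Q)) -> (forall x, `|f x| <= K) ->
  0 < r ->
  (forall c, prob P (f @^-1` [set t | c <= t <= c + 5 * r]) < 4 / 5) ->
  exists (G : set T) (H : set R) (sigma : T -> R),
    [/\ measurable G, 1 / 40 <= prob P G, 3 / 40 <= prob P (f @^-1` H) &
      forall w x, G w -> H (f x) ->
        r <= sigma w /\ sigma w <= `|f w - f x| <= 5 * sigma w].
Proof.
move=> mf fK r0 conc.
have e01 : 0 <= (1 / 10 : R) < 1 by lra.
have [a [a1 a2]] := grid_quantile mf fK r0 e01.
have mg (Q : set R) : measurable ((fun x => - f x) @^-1` Q).
  by have := mf (-%R @^-1` Q).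
have gK x : `|- f x| <= K by rewrite normrN.
have [b' [b1 b2]] := grid_quantile mg gK r0 e01.
pose b := - b'.
have {}b1 : prob P (f @^-1` [set t | b < t]) <= 1 / 10.
  move: b1; congr (prob P _ <= _); apply/seteqP; split => x /=; rewrite /b; lra.
have {}b2 : 1 / 10 < prob P (f @^-1` [set t | b - r < t]).
  move: b2; congr (_ < prob P _); apply/seteqP; split => x /=; rewrite /b; lra.
have cover (A B C : set T) : measurable A -> measurable B -> measurable C ->
    A `<=` B `|` C -> prob P A <= prob P B + prob P C.
  move=> mA mB mC ABC; apply: le_trans (probU _ mB mC).
  by apply: le_prob => //; exact: measurableU.
have mid : 4 / 5 <= prob P (f @^-1` [set t | a <= t <= b]).
  have h1 : prob P setT <= prob P (f @^-1` [set t | a <= t <= b]) +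
      prob P (f @^-1` [set t | t < a] `|` f @^-1` [set t | b < t]).
    apply: cover => //; first exact: measurableU.
    move=> x _ /=; case: (ltP (f x) a) => h; first by right; left.
    by case: (leP (f x) b) => h'; [left|right; right].
  have h2 : prob P (f @^-1` [set t | t < a] `|` f @^-1` [set t | b < t]) <=
      prob P (f @^-1` [set t | t < a]) + prob P (f @^-1` [set t | b < t]).
    exact: probU.
  by rewrite probT in h1; lra.
have ab : 5 * r < b - a.
  rewrite ltNge; apply/negP => h; have := conc a; rewrite ltNge => /negP; apply.
  apply: le_trans mid _; apply: le_prob => // x /= /andP[h1 h2]; lra.
pose q := b - a.
case: (leP (1 / 40) (prob P (f @^-1` [set t | b + q < t]))) => hi.
  exists (f @^-1` [set t | b + q < t]), [set t | a <= t <= b], (fun w => f w - b).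
  split => //; first lra.
  move=> w x /= h1 /andP[h2 h3]; rewrite /q in h1; split; first lra.
  by rewrite ger0_norm; lra.
case: (leP (1 / 40) (prob P (f @^-1` [set t | t < a - q]))) => lo.
  exists (f @^-1` [set t | t < a - q]), [set t | a <= t <= b], (fun w => a - f w).
  split => //; first lra.
  move=> w x /= h1 /andP[h2 h3]; rewrite /q in h1; split; first lra.
  by rewrite distrC ger0_norm; lra.
exists (f @^-1` [set t | b - r < t <= b + q]), [set t | a - q <= t < a + r],
  (fun w => q - 2 * r).
split => //.
- have : prob P (f @^-1` [set t | b - r < t]) <=
      prob P (f @^-1` [set t | b - r < t <= b + q]) +
      prob P (f @^-1` [set t | b + q < t]).
    apply: cover => // x /= h; case: (leP (f x) (b + q)) => h'; last by right.
    by left; rewrite h.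
  by lra.
- have : prob P (f @^-1` [set t | t < a + r]) <=
      prob P (f @^-1` [set t | a - q <= t < a + r]) +
      prob P (f @^-1` [set t | t < a - q]).
    apply: cover => // x /= h; case: (ltP (f x) (a - q)) => h'; first by right.
    by left; rewrite h.
  by lra.
- move=> w x /= /andP[h1 h2] /andP[h3 h4]; rewrite /q in h1 h2 h3 *.
  split; first lra.
  by rewrite ger0_norm; lra.
Qed.

End prob_sums.

(** * Krieger's Property A for product measures *)

Section log_weights.
Context (R : realType) (k : nat -> nat) (p : forall n, 'I_(k n).+2 -> R).
Local Notation Om := (product_space k).
Implicit Types (a x y : sequences k) (n m : nat).

(** Between two points that agree from [n] on, the difference of [logw 0 n] is
    the logarithm of the Radon-Nikodym cocycle of the product measure. *)
Definition logw n m x : R := \sum_(n <= i < m) ln (p (x i)).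

Lemma logw_cat n l m x : (n <= l)%N -> (l <= m)%N ->
  logw n m x = logw n l x + logw l m x.
Proof. by move=> nl lm; rewrite /logw (@big_cat_nat _ _ _ l). Qed.

Lemma eq_logw n m x y : (forall i, (n <= i < m)%N -> x i = y i) ->
  logw n m x = logw n m y.
Proof. by move=> xy; apply: eq_big_nat => i h; rewrite xy. Qed.

Lemma logw_bounded n m : exists K, forall x, `|logw n m x| <= K.
Proof.
exists (\sum_(n <= i < m) \sum_(v < (k i).+2) `|ln (p v)|) => x.
apply: le_trans (ler_norm_sum _ _ _) _; apply: ler_sum => i _.
rewrite (bigD1 (x i))//= lerDl; apply: sumr_ge0 => v _.
exact: normr_ge0.
Qed.

Lemma determined_logw n m (Q : set R) : determined m (logw n m @^-1` Q).
Proof.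
move=> x y xy; rewrite /preimage /= (@eq_logw n m x y)// => i /andP[_ im].
exact: xy.
Qed.

Lemma measurable_logw n m (Q : set R) :
  measurable (logw n m @^-1` Q : set Om).
Proof. exact: determined_measurable (@determined_logw n m Q). Qed.

End log_weights.
Arguments logw {R k} p n m x.

Section scales.
Context (R : realType) (k : nat -> nat) (p : forall n, 'I_(k n).+2 -> R).
Local Notation Om := (product_space k).
Context (P : probability Om R).
Hypothesis p_gt0 : forall n i, 0 < p (n:=n) i.
Hypothesis p_sum1 : forall n, \sum_(i < (k n).+2) p (n:=n) i = 1.
Hypothesis P_cyl : forall a n, P (cylinder a n) = (\prod_(i < n) p (a i))%:E.
Implicit Types (a x y z : sequences k) (n m : nat).

(** Ottaviani's maximal inequality: if each partial sum is concentrated, then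
    with positive probability all of them are at once. *)
Lemma concentrated_sup n (r : R) :
  (forall m, (n <= m)%N ->
    exists c, 4 / 5 <= prob P (logw p n m @^-1` [set t | c <= t <= c + r])) ->
  exists (A : set Om) (c : nat -> R), [/\ measurable A, 0 < prob P A &
    forall z, A z -> forall m, (n <= m)%N -> `|logw p n m z - c m| <= 2 * r].
Proof.
move=> hc.
have {hc} hc m : exists c, (n <= m)%N ->
    4 / 5 <= prob P (logw p n m @^-1` [set t | c <= t <= c + r]).
  case: (leqP n m) => [nm|_]; last by exists 0.
  by have [c ?] := hc _ nm; exists c.
have [c {}hc] := choice hc.
pose h m z := logw p n m z - c m.
have r0 : 0 <= r.
  rewrite leNgt; apply/negP => r0; have := hc n (leqnn n).
  rewrite (_ : _ @^-1` _ = set0); first by rewrite /prob measure0 /=; lra.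
  by apply/seteqP; split => // z /=; lra.
(* the first passage of [h] out of [-2r, 2r] *)
pose F j := [set z : Om | 2 * r < `|h (n + j)%N z| /\
  forall i, (i < j)%N -> `|h (n + i)%N z| <= 2 * r].
pose G j m := [set z : Om | `|h (n + m)%N z - h (n + j)%N z| <= r].
have eqh x y m : agree (n + m) x y -> h (n + m)%N x = h (n + m)%N y.
  move=> xy; congr (_ - _); apply: eq_logw => i /andP[_ im]; exact: xy.
have eqh' x y j m : (j <= m)%N -> agree (n + m) x y ->
    h (n + j)%N x = h (n + j)%N y.
  move=> jm xy; apply: eqh => i ij; apply: xy.
  by apply: leq_trans ij _; rewrite leq_add2l.
have dF j : determined (n + j) (F j).
  move=> x y xy [h1 h2]; split; first by rewrite -(eqh _ _ _ xy).
  by move=> i ij; rewrite -(eqh' _ _ _ _ (ltnW ij) xy) h2.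
have mF j : measurable (F j) := determined_measurable (@dF j).
have mG j m : (j <= m)%N -> measurable (G j m).
  move=> jm; apply: (@determined_measurable _ (n + m)) => x y xy.
  by rewrite /G /= (eqh' _ _ _ _ jm xy) (eqh _ _ _ xy).
have cG j m : (j <= m)%N ->
    forall x y, (forall i, (n + j <= i)%N -> x i = y i) -> G j m x -> G j m y.
  move=> jm x y xy; rewrite /G /= /h.
  have nj : (n + j <= n + m)%N by rewrite leq_add2l.
  rewrite !(@logw_cat _ _ p n (n + j) (n + m))// ?leq_addr//.
  rewrite (@eq_logw _ _ p (n + j)%N (n + m)%N x y); last first.
    by move=> i /andP[ji _]; exact: xy.
  congr (`|_| <= _); lra.
have hG j m : (j <= m)%N -> 3 / 5 <= prob P (G j m).
  move=> jm.
  have mI l := measurable_logw p n (n + l)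
                 [set t | c (n + l)%N <= t <= c (n + l)%N + r].
  have := probD P (mI m) (measurableC (mI j)).
  rewrite probC//; have := hc (n + m)%N (leq_addr _ _).
  have := hc (n + j)%N (leq_addr _ _).
  move=> h1 h2 h3.
  have : prob P (logw p n (n + m) @^-1`
      [set t | c (n + m)%N <= t <= c (n + m)%N + r] `\`
      ~` (logw p n (n + j) @^-1`
      [set t | c (n + j)%N <= t <= c (n + j)%N + r])) <= prob P (G j m).
    apply: le_prob; [|exact: mG|].
      by apply: measurableD => //; exact: measurableC.
    move=> z [/= /andP[u1 u2] /contrapT /andP[v1 v2]].
    by rewrite /G /= /h ler_norml; lra.
  by lra.
pose A m := [set z : Om | forall i, (i < m)%N -> `|h (n + i)%N z| <= 2 * r].
have mA m : measurable (A m).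
  apply: (@determined_measurable _ (n + m)) => x y xy Ax i im.
  by rewrite -(eqh' _ _ _ _ (ltnW im) xy) Ax.
have pA m : 2 / 3 <= prob P (A m).
  have AF : ~` A m `<=` \big[setU/set0]_(j < m) F j.
    move=> z; rewrite -bigcup_mkord => nA.
    have ex : exists j, (j < m)%N && (2 * r < `|h (n + j)%N z|).
      apply: contrapT => nex; apply: nA => i im.
      by rewrite leNgt; apply/negP => him; apply: nex; exists i; rewrite im.
    case: (ex_minnP ex) => j /andP[jm hj] jmin; exists j => //; split => // i ij.
    rewrite leNgt; apply/negP => hi; have := jmin i.
    by rewrite hi (ltn_trans ij jm) => /(_ isT); rewrite leqNgt ij.
  have h1 : prob P (~` A m) <= \sum_(j < m) prob P (F j).
    apply: le_trans (prob_union_le P m mF); apply: le_prob => //.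
      exact: measurableC.
    by apply: bigsetU_measurable.
  pose B : set Om := ~` (logw p n (n + m) @^-1`
                 [set t | c (n + m)%N <= t <= c (n + m)%N + r]).
  have mB : measurable B by apply: measurableC; exact: measurable_logw.
  pose E j : set Om := if (j <= m)%N then F j `&` G j m else set0.
  have h2 : \sum_(j < m) prob P (E j) <= prob P B.
    apply: prob_sum_le => //.
    - by move=> j; rewrite /E; case: ifPn => // jm; apply: measurableI; auto.
    - apply/trivIsetP => i j _ _ ij; rewrite /E.
      wlog : i j ij / (i < j)%N.
        move=> H; case: (ltngtP i j) (ij) => // [lij|lji] _; first exact: H.
        by rewrite setIC; apply: H => //; rewrite eq_sym.
      move=> lij; case: ifPn => // im; last by rewrite set0I.
      case: ifPn => // jm; last by rewrite setI0.
      apply/seteqP; split => // z [[[Fi _] _] [[_ Fj] _]].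
      by have := Fj i lij; rewrite leNgt Fi.
    - move=> j; rewrite /E; case: ifPn => [jm|_]; last exact: sub0set.
      move=> z [[h3 _] h4] /= /andP[h5 h6].
      have : `|h (n + m)%N z| <= r by rewrite /h ler_norml; lra.
      move: h3 h4; rewrite /G /= => h3 h4 h7.
      have := ler_distD (h (n + m)%N z) (h (n + j)%N z) 0.
      by rewrite !subr0 (distrC (h (n + j)%N z)); lra.
  have h3 : \sum_(j < m) (prob P (F j) * (3 / 5)) <= \sum_(j < m) prob P (E j).
    apply: ler_sum => j _; rewrite /E (ltnW (ltn_ord j)).
    rewrite (independent p_sum1 P_cyl (mG _ _ (ltnW (ltn_ord j))) (@dF j)
      (cG _ _ (ltnW (ltn_ord j)))).
    by rewrite ler_wpM2l ?prob_ge0// hG// ltnW.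
  have h4 : prob P B <= 1 / 5.
    rewrite /B probC; last exact: measurable_logw.
    by have := hc (n + m)%N (leq_addr _ _); lra.
  rewrite -mulr_suml in h3; rewrite probC// in h1; lra.
exists (lim_sup_set A), c; split.
- by apply: bigcapT_measurable => i; exact: bigcup_measurable.
- by apply: lt_le_trans (prob_limsup mA pA); lra.
- move=> z Az m nm.
  have [j /= lj Aj] := Az (m - n).+1 I.
  by have := Aj (m - n)%N lj; rewrite /h subnKC.
Qed.

(** What the asymptotic ratio [0] says about pairs of points, without full
    groups. *)
Definition unbounded_ratio := forall A : set Om, measurable A -> 0 < prob P A ->
  forall r : R, exists z z' n, [/\ A z, A z',
    forall i, (n <= i)%N -> z i = z' i & r < `|logw p 0 n z' - logw p 0 n z|].

(** On the set of [concentrated_sup], tail equivalent points differ in log-weight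
    by at most [4 r], up to the bounded contribution of the first coordinates. *)
Lemma not_concentrated n (r : R) : unbounded_ratio ->
  exists2 m, (n <= m)%N &
    forall c, prob P (logw p n m @^-1` [set t | c <= t <= c + r]) < 4 / 5.
Proof.
move=> ratio; apply: contrapT => h.
have [m nm|A [c [mA A0 cA]]] := @concentrated_sup n r.
  apply: contrapT => hm; apply: h; exists m => // c.
  by rewrite ltNge; apply/negP => hc; apply: hm; exists c.
have [K hK] := logw_bounded p 0 n.
have [z [z' [l [Az Az' zz']]]] := ratio A mA A0 (4 * r + 2 * K).
apply/negP; rewrite -leNgt.
have ext : logw p 0 l z' - logw p 0 l z =
    logw p 0 (maxn l n) z' - logw p 0 (maxn l n) z.
  rewrite !(@logw_cat _ _ p 0 l (maxn l n))// ?leq_maxl//.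
  rewrite (@eq_logw _ _ p l (maxn l n) z z'); first by lra.
  by move=> i /andP[li _]; exact: zz'.
rewrite ext !(@logw_cat _ _ p 0 n (maxn l n))// ?leq_maxr//.
have := cA _ Az (maxn l n) (leq_maxr _ _).
have := cA _ Az' (maxn l n) (leq_maxr _ _).
have := hK z; have := hK z'; rewrite !ler_norml.
move=> /andP[? ?] /andP[? ?] /andP[? ?] /andP[? ?].
by apply/andP; split; lra.
Qed.

(** Inside a cylinder that [B] almost fills, the block of coordinates from [n0]
    to [m] is replaced by that of a point [w].  On average over [w] this keeps
    the law of the point, so for many [w] most points stay in [B]; by
    [two_scales] one of these moves a fixed proportion of points by a log-weight
    of order [sigma w], which is large when the sum over the block is not
    concentrated.  The constants only have to satisfy
    [1/1600 <= 1/40 * 1/40] and [1/40 + 1/40 + 1/1600 <= 3/40]. *)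
Lemma recurrent_scales (B : set Om) (t : nat -> R) : unbounded_ratio ->
  measurable B -> 0 < prob P B ->
  exists (s : nat -> R) (K : set Om),
    [/\ forall j, t j <= s j, measurable K, 0 < prob P K, K `<=` B &
      forall z, K z -> forall j0, exists2 j, (j0 <= j)%N &
        exists z' n, [/\ B z', forall i, (n <= i)%N -> z i = z' i &
          expR (s j) <= `|logw p 0 n z' - logw p 0 n z| <= 5 * expR (s j)]].
Proof.
move=> ratio mB B0.
have b01 : 0 < (1 / 1600 : R) <= 1 by lra.
have c0 : 0 <= (1 / 40 : R) by lra.
have [n0 [x0 dens]] := density p_sum1 P_cyl mB B0 b01.
pose B1 := fiber n0 x0 B.
have mB1 : measurable B1 by exact: measurable_fiber.
have mC1 : measurable (~` B1) by exact: measurableC.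
have mC : measurable (cylinder x0 n0 : set Om) by exact: measurable_cylinder.
pose g := prob P (cylinder x0 n0).
have g0 : 0 < g.
  by rewrite -prob_gt0// [ltRHS]P_cyl lte_fin prodr_gt0.
have step (t0 : R) : exists (s : R) (K : set Om),
    [/\ t0 <= s, measurable K, g / 40 <= prob P K, K `<=` B &
      forall z, K z -> exists z' n, [/\ B z', forall i, (n <= i)%N -> z i = z' i &
          expR s <= `|logw p 0 n z' - logw p 0 n z| <= 5 * expR s]].
  have [m nm conc] := not_concentrated n0 (5 * expR t0) ratio.
  have [Kb hKb] := logw_bounded p n0 m.
  have [G [H [sigma [mG pG pH GH]]]] :=
    two_scales (@measurable_logw _ _ p n0 m) hKb (expR_gt0 t0) conc.
  have hB1 : prob P (~` B1) < 1 / 40 * prob P G by rewrite /B1; lra.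
  have [w Gw hw] := small_fiber p_sum1 P_cyl m mG mC1 c0 hB1.
  have mfw : measurable (fiber m w (~` B1)) by exact: measurable_fiber.
  pose K' : set Om := (logw p n0 m @^-1` H) `\` (~` B1 `|` fiber m w (~` B1)).
  have mH : measurable (logw p n0 m @^-1` H : set Om) by exact: measurable_logw.
  have mU : measurable (~` B1 `|` fiber m w (~` B1)) by exact: measurableU.
  have mK' : measurable K' by exact: measurableD.
  have pK' : 1 / 40 <= prob P K'.
    have := probD P mH mU; have := probU P mC1 mfw; rewrite -/K'.
    have : prob P (~` B1) < 1 / 1600 by [].
    by move: hw pH; lra.
  have coK x y : (forall i, (n0 <= i)%N -> x i = y i) -> K' x -> K' y.
    move=> xy.
    (* the coordinates of [u] and [v] before [n0] are overwritten by [x0] *)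
    have eqm l u v : (forall i, (n0 <= i)%N -> u i = v i) ->
        merge l x0 u = merge l x0 v \/ (l < n0)%N.
      move=> uv; case: (ltnP l n0) => ln; [by right|left].
      apply: functional_extensionality_dep => i; rewrite /merge.
      by case: ltnP => // li; apply: uv; exact: leq_trans li.
    have B1xy u v : (forall i, (n0 <= i)%N -> u i = v i) -> B1 u -> B1 v.
      move=> uv; rewrite /B1 /fiber /=.
      by case: (eqm n0 u v uv) => [->|]; rewrite ?ltnn.
    have mw i : (n0 <= i)%N -> merge m w x i = merge m w y i.
      move=> ni; rewrite /merge; case: ltnP => // mi.
      exact: xy.
    move=> [h1 /not_orP[/contrapT h2 /contrapT h3]]; split.
      by rewrite /preimage /= -(@eq_logw _ _ p n0 m x y)// => i /andP[/xy].
    move=> [|]; first by apply; exact: B1xy h2.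
    by apply; exact: B1xy h3.
  exists (ln (sigma w)), (cylinder x0 n0 `&` K').
  have Hne : exists x, H (logw p n0 m x).
    apply: contrapT => nex; move: pH; rewrite (_ : _ @^-1` _ = set0).
      by rewrite /prob measure0 /=; lra.
    by apply/seteqP; split => // x Hx; apply: nex; exists x.
  have [x1 Hx1] := Hne.
  have [sw _] := GH w x1 Gw Hx1.
  have sw0 : 0 < sigma w by apply: lt_le_trans sw; exact: expR_gt0.
  have dC : determined n0 (cylinder x0 n0).
    by move=> x y xy xa i ni; rewrite -xy// xa.
  split.
  - by rewrite -[t0]expRK ler_ln ?posrE ?expR_gt0.
  - exact: measurableI.
  - rewrite (independent p_sum1 P_cyl mK' dC coK) -/g.
    by rewrite ler_pM2l//; move: pK'; lra.
  - move=> z [Cz [_ /not_orP[/contrapT h2 _]]]; move: h2; rewrite /B1 /fiber /=.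
    congr B; apply: functional_extensionality_dep => i; rewrite /merge.
    by case: ltnP => // /Cz.
  - move=> z [Cz [h1 /not_orP[/contrapT h2 /contrapT h3]]].
    exists (merge n0 x0 (merge m w z)), m; split => //.
      move=> i mi; rewrite merge_ge ?merge_ge//; exact: leq_trans mi.
    rewrite lnK// !(@logw_cat _ _ p 0 n0 m)//.
    rewrite (@eq_logw _ _ p 0 n0 (merge n0 x0 (merge m w z)) z); last first.
      by move=> i /andP[_ i0]; rewrite merge_lt// Cz.
    rewrite (@eq_logw _ _ p n0 m (merge n0 x0 (merge m w z)) w); last first.
      by move=> i /andP[ni im]; rewrite merge_ge// merge_lt.
    rewrite (_ : _ + _ - _ = logw p n0 m w - logw p n0 m z); last by lra.
    by have [_] := GH w z Gw h1.
have [s hs] := choice (fun j => step (t j)).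
have [K hK] := choice hs.
have mK j : measurable (K j) by case: (hK j).
have pK j : g / 40 <= prob P (K j) by case: (hK j).
exists s, (lim_sup_set K); split.
- by move=> j; case: (hK j).
- by apply: bigcapT_measurable => i; exact: bigcup_measurable.
- by apply: lt_le_trans (prob_limsup mK pK); rewrite divr_gt0.
- by move=> z /(_ 0%N I)[j _]; case: (hK j) => _ _ _ + _; apply.
- move=> z Kz j0; have [j j0j Kj] := Kz j0 I.
  by exists j => //; have [_ _ _ _ +] := hK j; apply.
Qed.

End scales.

(** * Generators of the tail relation *)

Section swap.
Context (R : realType) (k : nat -> nat) (p : forall n, 'I_(k n).+2 -> R).
Local Notation Om := (product_space k).
Context (P : probability Om R).
Hypothesis p_gt0 : forall n i, 0 < p (n:=n) i.
Hypothesis p_sum1 : forall n, \sum_(i < (k n).+2) p (n:=n) i = 1.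
Hypothesis P_cyl : forall a n, P (cylinder a n) = (\prod_(i < n) p (a i))%:E.
Implicit Types (a b x y z : sequences k) (n m : nat).

(** Exchanges the prefixes of length [n] of [a] and [b].  These involutions, with
    [a] and [b] in the countable range of [decode], generate the tail relation. *)
Definition swap n a b z : sequences k :=
  if `[<agree n z a>] then merge n b z else
  if `[<agree n z b>] then merge n a z else z.

Lemma merge_self n a z : agree n z a -> merge n a z = z.
Proof.
move=> za; apply: functional_extensionality_dep => i; rewrite /merge.
by case: ifP => // im; rewrite za.
Qed.

Lemma merge_merge n a b z : merge n a (merge n b z) = merge n a z.
Proof.
apply: functional_extensionality_dep => i; rewrite /merge.
by case: (i < n)%N.
Qed.

Lemma agree_merge n a z : agree n (merge n a z) a.
Proof. by move=> i im; rewrite merge_lt. Qed.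

Lemma swapE n a b z : agree n z a -> swap n a b z = merge n b z.
Proof. by move=> za; rewrite /swap asboolT. Qed.

Lemma swapC n a b : swap n a b = swap n b a.
Proof.
apply/funext => z; rewrite /swap.
case: (asboolP (agree n z a)) => za; case: (asboolP (agree n z b)) => zb //.
by rewrite !merge_self.
Qed.

Lemma swapK n a b z : swap n a b (swap n a b z) = z.
Proof.
wlog za : a b / agree n z a.
  move=> H; case: (pselect (agree n z a)) => za; first exact: H.
  case: (pselect (agree n z b)) => zb; first by rewrite swapC; exact: H.
  by rewrite /swap !(asboolF za, asboolF zb).
rewrite (swapE _ za) swapC swapE; last exact: agree_merge.
by rewrite merge_merge merge_self.
Qed.

Lemma swap_tail n a b z i : (n <= i)%N -> swap n a b z i = z i.
Proof.
by move=> ni; rewrite /swap; case: ifP => _; [|case: ifP => _];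
  rewrite ?merge_ge.
Qed.

Lemma measurable_swap n a b : measurable_fun [set: Om] (swap n a b : Om -> Om).
Proof.
move=> _ B mB; rewrite setTI.
pose ca : set Om := cylinder a n; pose cb : set Om := cylinder b n.
have mca : measurable ca by exact: measurable_cylinder.
have mcb : measurable cb by exact: measurable_cylinder.
have -> : swap n a b @^-1` B = (ca `&` fiber n b B) `|`
    (((cb `\` ca) `&` fiber n a B) `|` (~` (ca `|` cb) `&` B)).
  apply/seteqP; split => z; rewrite /preimage /= /swap.
    case: asboolP => za; first by left.
    case: asboolP => zb Bz; first by right; left.
    by right; right; split => // -[].
  case: asboolP => za; first by move=> [[]|[[[_ []]]|[/not_orP[]]]].
  by case: asboolP => zb [[]|[[[]]|[/not_orP[]]]].
have mfib c : measurable (fiber n c B) by exact: measurable_fiber.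
apply: measurableU; first exact: measurableI.
apply: measurableU; first by apply: measurableI => //; exact: measurableD.
by apply: measurableI => //; apply: measurableC; exact: measurableU.
Qed.

Lemma P_cylinder_fiber n a b (V : set Om) : measurable V ->
  prob P (cylinder b n `&` fiber n a V) =
  prob P (cylinder b n) * prob P (fiber n a V).
Proof.
move=> mV; apply: (independent p_sum1 P_cyl (n := n)).
- exact: measurable_fiber.
- by move=> x y xy xa i ni; rewrite -xy// xa.
- move=> x y xy; rewrite /fiber /=; congr V.
  apply: functional_extensionality_dep => i; rewrite /merge.
  by case: ltnP => // /xy.
Qed.

Lemma prob_cylinder n a : prob P (cylinder a n) = expR (logw p 0 n a).
Proof.
rewrite /prob [X in fine X]P_cyl /= /logw big_mkord expR_sum.
by apply: eq_bigr => i _; rewrite lnK// posrE.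
Qed.

(** The set and its image have the same fiber over their prefixes, so only the
    weights of the prefixes differ. *)
Lemma prob_swap n a b (V : set Om) : measurable V -> V `<=` cylinder a n ->
  prob P (swap n a b @^-1` V) =
  expR (logw p 0 n b - logw p 0 n a) * prob P V.
Proof.
move=> mV Va.
have -> : swap n a b @^-1` V = cylinder b n `&` fiber n a V.
  apply/seteqP; split => z.
    rewrite /preimage /= => Vz; have za := Va _ Vz.
    rewrite -(swapK n a b z) (swapE _ za); split; first exact: agree_merge.
    by rewrite /fiber /= merge_merge merge_self.
  by move=> [zb]; rewrite /fiber /preimage /= swapC swapE.
have hV : V = cylinder a n `&` fiber n a V.
  apply/seteqP; split => z; last by move=> [za]; rewrite /fiber /= merge_self.
  by move=> Vz; have za := Va _ Vz; split => //; rewrite /fiber /= merge_self.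
rewrite [in RHS]hV !P_cylinder_fiber// !prob_cylinder mulrA.
by rewrite -expRD subrK.
Qed.

Lemma null_swap n a b (V : set Om) : measurable V -> P V = 0%E ->
  P (swap n a b @^-1` V) = 0%E.
Proof.
move=> mV V0.
have fV0 c : P (fiber n c V) = 0%E.
  have mf : measurable (fiber n c V) by exact: measurable_fiber.
  have mc := measurable_cylinder n c.
  have h : prob P (cylinder c n `&` fiber n c V) = 0.
    rewrite /prob (subset_measure0 _ mV _ V0)//; first exact: measurableI.
    by move=> z [zc]; rewrite /fiber /= merge_self.
  move: h; rewrite P_cylinder_fiber// prob_cylinder => /eqP.
  by rewrite mulf_eq0 gt_eqF ?expR_gt0//= => /eqP h; rewrite probE// h.
have ms : measurable (swap n a b @^-1` V : set Om).
  by rewrite -[X in measurable X]setTI; exact: measurable_swap.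
apply/(negligibleP P ms).
apply: (@negligibleS _ _ _ P (fiber n a V `|` (fiber n b V `|` V))).
  move=> z; rewrite /preimage /= /swap /fiber /=.
  case: asboolP => za; first by right; left.
  by case: asboolP => zb; [left|right; right].
have ng c : P.-negligible (fiber n c V).
  by apply/negligibleP; [exact: measurable_fiber|exact: fV0].
by apply: negligibleU => //; apply: negligibleU => //; exact/negligibleP.
Qed.

End swap.

(** * Comparison of equivalent measures *)

Section comparable.
Context d (X : measurableType d) (R : realType).
Context (m : {sigma_finite_measure set X -> \bar R}) (l : probability X R).
Hypothesis lm : forall A, measurable A -> m A = 0%E -> l A = 0%E.
Hypothesis ml : forall A, measurable A -> l A = 0%E -> m A = 0%E.

(** Equivalent measures are comparable, up to a multiplicative constant, on
    the subsets of some set of positive measure: the sets where the density lies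
    between [expR (- j)] and [expR j] exhaust the space. *)
Lemma comparable_on (A : set X) : measurable A -> m A != 0%E ->
  exists (A1 : set X) (M : R), [/\ measurable A1, A1 `<=` A, m A1 != 0%E, 0 <= M &
    forall V, measurable V -> V `<=` A1 ->
      ((expR (- M))%:E * m V <= l V)%E /\ (l V <= (expR M)%:E * m V)%E].
Proof.
move=> mA A0.
have lm' : l `<< m by apply/null_content_dominatesP.
pose g := Radon_Nikodym_SigmaFinite.f l m.
have g0 : forall x, (0 <= g x)%E := Radon_Nikodym_SigmaFinite.f_ge0 lm'.
have gfin : forall x, g x \is a fin_num := Radon_Nikodym_SigmaFinite.f_fin_num lm'.
have mg : measurable_fun setT g.
  exact: measurable_int (Radon_Nikodym_SigmaFinite.f_integrable lm').
have gI := Radon_Nikodym_SigmaFinite.f_integral lm'.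
pose B (j : nat) := A `&` [set x | ((expR (- j%:R))%:E <= g x <= (expR j%:R)%:E)%E].
have mB j : measurable (B j).
  apply: measurableI => //.
  have -> : [set x | ((expR (- j%:R))%:E <= g x <= (expR j%:R)%:E)%E] =
      g @^-1` `[(expR (- j%:R))%:E, (expR j%:R)%:E]%classic.
    by apply/seteqP; split => x; rewrite /preimage /= in_itv.
  by rewrite -[X in measurable X]setTI; apply: mg => //; exact: emeasurable_itv.
have [[j Bj]|nB] := pselect (exists j, m (B j) != 0%E).
  exists (B j), j%:R; split => //; first by move=> x [].
  move=> V mV VB; rewrite gI// -!integral_cst//; split.
    apply: ge0_le_integral => //.
    - by move=> x _; rewrite /cst lee_fin expR_ge0.
    - exact: measurable_funTS.
    - by move=> x /VB[_ /andP[]].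
  apply: ge0_le_integral => //.
  - exact: measurable_funTS.
  - by move=> x /VB[_ /andP[]].
pose Z := g @^-1` [set 0%E].
have mZ : measurable Z.
  by rewrite -[X in measurable X]setTI; apply: mg => //; exact: emeasurable_set1.
have Z0 : m Z = 0%E.
  apply: ml => //; rewrite gI//; apply: integral0_eq => x; exact.
exfalso; move/eqP: A0; apply.
apply/(negligibleP m mA).
apply: (@negligibleS _ _ _ m (Z `|` \bigcup_j B j)); last first.
  apply: negligibleU; first exact/negligibleP.
  apply: negligible_bigcup => j; apply/negligibleP => //.
  by apply: contrapT => h; apply: nB; exists j; apply/eqP.
move=> x Ax; have := g0 x; have := gfin x; case gx : (g x) => [r| |]// _.
rewrite lee_fin le_eqVlt => /orP[/eqP r0|r0].
  by left; rewrite /Z /preimage /= gx -r0.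
right; exists (Num.bound `|ln r|) => //; split => //=.
rewrite gx !lee_fin -[X in _ <= X <= _](lnK (x := r)) ?posrE// !ler_expR.
by rewrite -ler_norml ltW// archi_boundP.
Qed.

End comparable.

(** * Transfer of the cocycle by an orbit equivalence *)

Lemma ae_forall_count d (X : measurableType d) (R : realType)
    (m : {measure set X -> \bar R}) (I : countType) (Q : I -> X -> Prop) :
  (forall i, \forall x \ae m, Q i x) -> \forall x \ae m, forall i, Q i x.
Proof.
move=> hQ.
have : \forall x \ae m, forall j, oapp (fun i => Q i x) True (unpickle j : option I).
  apply: ae_foralln => j; case: (unpickle j) => [i|] /=; first exact: hQ.
  exact: aeW.
by apply: filterS => x h i; have := h (pickle i); rewrite pickleK.
Qed.

(** Saturations of null sets are null. *)
Lemma ae_class d (X : measurableType d) (R : realType)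
    (m : {measure set X -> \bar R}) (E : set (X * X)) (Q : X -> Prop) :
  countable_measured_eqv m E -> (\forall x \ae m, Q x) ->
  \forall x \ae m, forall x', E (x, x') -> Q x'.
Proof.
move=> E_eqv [N [mN N0 hN]].
apply: (@negligibleS _ _ _ m (saturation E N)); last exact: (eqv_null E_eqv).
move=> x /= /existsNP[x' /not_implyP[xx' h]]; exists x'; first exact: hN.
exact: (eqv_sym E_eqv).
Qed.

Section transfer.
Context (R : realType) (k : nat -> nat) (p : forall n, 'I_(k n).+2 -> R).
Local Notation Om := (product_space k).
Context (P : probability Om R).
Hypothesis p_gt0 : forall n i, 0 < p (n:=n) i.
Hypothesis p_sum1 : forall n, \sum_(i < (k n).+2) p (n:=n) i = 1.
Hypothesis P_cyl : forall a n, P (cylinder a n) = (\prod_(i < n) p (a i))%:E.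
Context d (X : measurableType d) (m : {sigma_finite_measure set X -> \bar R}).
Context (E : set (X * X)) (delta : X * X -> R).
Hypothesis E_eqv : countable_measured_eqv m E.
Hypothesis E_rn : RN_cocycle m E delta.
Context (S : X -> Om) (T : Om -> X).
Hypothesis mS : measurable_fun [set: X] S.
Hypothesis mT : measurable_fun [set: Om] T.
Hypothesis TS : {ae m, forall x, T (S x) = x}.
Hypothesis ST : {ae P, forall z, S (T z) = z}.
Hypothesis mP : forall B, measurable B -> (m (S @^-1` B) = 0%E <-> P B = 0%E).
Hypothesis orbS :
  {ae m, forall x, S @` eqv_class E x = eqv_class (@tail_eqv k) (S x)}.

Lemma measurable_preS B : measurable B -> measurable (S @^-1` B).
Proof. by move=> mB; rewrite -[X in measurable X]setTI; exact: mS. Qed.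

Lemma measurable_preT A : measurable A -> measurable (T @^-1` A).
Proof. by move=> mA; rewrite -[X in measurable X]setTI; exact: mT. Qed.

Lemma nullT A : measurable A -> (m A = 0%E <-> P (T @^-1` A) = 0%E).
Proof.
move=> mA; have [N [mN N0 hN]] := TS.
have mTA := measurable_preT mA; have mSTA := measurable_preS mTA.
have hTS x : ~ N x -> T (S x) = x by move=> nN; apply: contrapT => /hN.
rewrite -mP//; split => A0.
  apply/(negligibleP m mSTA); apply: (@negligibleS _ _ _ m (A `|` N)).
    move=> x; rewrite /preimage /=; case: (pselect (N x)) => Nx; first by right.
    by rewrite hTS//; left.
  by apply: negligibleU; exact/negligibleP.
apply/(negligibleP m mA).
apply: (@negligibleS _ _ _ m ((S @^-1` (T @^-1` A)) `|` N)).
  move=> x; case: (pselect (N x)) => Nx; first by right.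
  by left; rewrite /preimage /= hTS.
by apply: negligibleU; exact/negligibleP.
Qed.

(** The points at which the orbit equivalence behaves as an everywhere defined
    bijection between the class of [x] and that of [S x]. *)
Definition matched x := [/\ T (S x) = x,
  forall x', E (x, x') -> T (S x') = x' /\ tail_eqv (S x, S x') &
  forall z, tail_eqv (S x, z) -> E (x, T z) /\ S (T z) = z].

Lemma ae_matched : \forall x \ae m, matched x.
Proof.
have sN := ae_class E_eqv TS.
move: sN TS orbS; apply: filterS3 => x h TSx orb; split => //.
  move=> x' xx'; split; first exact: h.
  have : (S @` eqv_class E x) (S x') by exists x'.
  by rewrite orb.
move=> z xz; have : eqv_class (@tail_eqv k) (S x) z by [].
by by rewrite -orb => -[x' xx' <-]; rewrite h.
Qed.

Section swap_aut.
Context (n : nat) (a b : sequences k).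
Local Notation th := (swap n a b : Om -> Om).

(** The swap is conjugated to [X]; it becomes an everywhere defined involution by
    taking the identity on an invariant null set [N]. *)
Lemma swap_aut : exists (phi : X -> X) (N : set X),
  [/\ full_group m E phi, (forall x, phi (phi x) = x),
      measurable_fun [set: X] phi, measurable N /\ m N = 0%E &
      (forall x, ~ N x -> phi x = T (th (S x))) /\
      (forall V, measurable V -> V `<=` ~` N ->
        (forall x, V x -> agree n (S x) a) ->
        prob P (T @^-1` (phi @^-1` V)) =
        expR (logw p 0 n b - logw p 0 n a) * prob P (T @^-1` V))].
Proof.
have [N [mN N0 hN]] := TS.
have hTS x : ~ N x -> T (S x) = x by move=> nN; apply: contrapT => /hN.
have [M [mM M0 hM]] := ST.
have hST z : ~ M z -> S (T z) = z by move=> nM; apply: contrapT => /hM.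
have mth : measurable_fun [set: Om] th := @measurable_swap k n a b.
have mpre (B : set Om) : measurable B -> measurable (th @^-1` B).
  by move=> mB; rewrite -[X in measurable X]setTI; exact: mth.
have thK z : th (th z) = z := swapK n a b z.
pose Q : set Om := (M `|` T @^-1` N) `|` (th @^-1` (M `|` T @^-1` N)).
have mMN : measurable (M `|` T @^-1` N).
  by apply: measurableU => //; exact: measurable_preT.
have mQ : measurable Q by apply: measurableU => //; exact: mpre.
have Q0 : P Q = 0%E.
  have MN0 : P (M `|` T @^-1` N) = 0%E.
    apply/(negligibleP P mMN); apply: negligibleU; first exact/negligibleP.
    by apply/(negligibleP P (measurable_preT mN)); exact/nullT.
  apply/(negligibleP P mQ); apply: negligibleU; first exact/negligibleP.
  apply/(negligibleP P (mpre _ mMN)).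
  exact: (null_swap p_gt0 p_sum1 P_cyl).
have thQ z : ~ Q z -> ~ Q (th z).
  by move=> nQ; apply: contra_not nQ => -[h|]; rewrite /preimage /= ?thK;
    [right|left].
pose N1 := N `|` S @^-1` Q.
have mN1 : measurable N1 by apply: measurableU => //; exact: measurable_preS.
have N10 : m N1 = 0%E.
  apply/(negligibleP m mN1); apply: negligibleU; first exact/negligibleP.
  by apply/(negligibleP m (measurable_preS mQ)); exact/mP.
pose phi x := if `[<N1 x>] then x else T (th (S x)).
have phiN x : N1 x -> phi x = x by move=> Nx; rewrite /phi asboolT.
have phiE x : ~ N1 x -> phi x = T (th (S x)) by move=> Nx; rewrite /phi asboolF.
(* away from [Q], [T] is inverted by [S] and takes its values off [N1] *)
have TQ z : ~ Q z -> S (T z) = z /\ ~ N1 (T z).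
  move=> nQ; have STz : S (T z) = z.
    by apply: hST => Mz; apply: nQ; left; left.
  split => // -[NT|]; last by rewrite /preimage /= STz.
  by apply: nQ; left; right.
have nN1 x : ~ N1 x -> T (S x) = x /\ ~ Q (S x).
  by move=> /not_orP[/hTS].
have phiK x : phi (phi x) = x.
  case: (pselect (N1 x)) => Nx; first by rewrite !phiN.
  have [TSx nQ] := nN1 _ Nx.
  have [STx nNT] := TQ _ (thQ _ nQ).
  by rewrite (phiE _ Nx) (phiE _ nNT) STx thK.
have mphi : measurable_fun [set: X] phi.
  move=> _ A mA; rewrite setTI.
  have -> : phi @^-1` A = (N1 `&` A) `|`
      (~` N1 `&` S @^-1` (th @^-1` (T @^-1` A))).
    apply/seteqP; split => x; rewrite /preimage /=.
      case: (pselect (N1 x)) => Nx; first by rewrite phiN//; left.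
      by rewrite phiE//; right.
    by move=> [[Nx Ax]|[Nx Ax]]; [rewrite phiN|rewrite phiE].
  apply: measurableU; apply: measurableI => //; first exact: measurableC.
  by apply: measurable_preS; apply: mpre; exact: measurable_preT.
have phi0 A : measurable A -> m A = 0%E -> m (phi @^-1` A) = 0%E.
  move=> mA A0.
  have mpA : measurable (phi @^-1` A).
    by rewrite -[X in measurable X]setTI; exact: mphi.
  have mTA := measurable_preT mA.
  apply/(negligibleP m mpA).
  apply: (@negligibleS _ _ _ m (A `|` S @^-1` (th @^-1` (T @^-1` A)))).
    move=> x; rewrite /preimage /=.
    case: (pselect (N1 x)) => Nx; first by rewrite phiN//; left.
    by rewrite phiE//; right.
  apply: negligibleU; first exact/negligibleP.
  apply/(negligibleP m (measurable_preS (mpre _ mTA))).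
  apply/mP; first exact: mpre.
  apply: (null_swap p_gt0 p_sum1 P_cyl) => //.
  exact/nullT.
exists phi, N1; split => //.
- split.
    exists phi; split => // A mA; split; last exact: phi0.
    move=> A0; have -> : A = phi @^-1` (phi @^-1` A).
      by apply/seteqP; split => x; rewrite /preimage /= phiK.
    apply: phi0 => //; rewrite -[X in measurable X]setTI; exact: mphi.
  have := ae_matched; apply: filterS => x [_ _ h].
  case: (pselect (N1 x)) => Nx; first by rewrite phiN//; exact: (eqv_refl E_eqv).
  rewrite phiE//; have [|//] := h (th (S x)).
  by exists n => i ni; rewrite /= swap_tail.
- split => // V mV VN Va.
  have mTV := measurable_preT mV.
  have mpV : measurable (phi @^-1` V).
    by rewrite -[X in measurable X]setTI; exact: mphi.
  pose W : set Om := T @^-1` V `\` Q.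
  have mW : measurable W by exact: measurableD.
  have nullD (B : set Om) : measurable B -> prob P (B `\` Q) = prob P B.
    move=> mB; apply: le_anti; apply/andP; split.
      by apply: le_prob (measurableD mB mQ) mB _ => z [].
    have := probD P mB mQ; rewrite [prob P Q]/prob Q0 /=; lra.
  rewrite -(nullD _ mTV) -(nullD _ (measurable_preT mpV)) -/W.
  have -> : T @^-1` (phi @^-1` V) `\` Q = th @^-1` W.
    apply/seteqP; split => z; rewrite /preimage /=.
      move=> [Vz nQ]; have [STz nN] := TQ _ nQ.
      by move: Vz; rewrite (phiE _ nN) STz; split => //; exact: thQ.
    move=> [Vz nQ]; have nQz : ~ Q z by rewrite -[z]thK; exact: thQ.
    have [STz nN] := TQ _ nQz; split => //.
    by rewrite (phiE _ nN) STz.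
  apply: (prob_swap p_gt0 p_sum1 P_cyl) => // z [Vz nQ].
  by have := Va _ Vz; rewrite (TQ _ nQ).1.
Qed.

End swap_aut.

(** On the set where the bound fails in one direction, [phi] multiplies [m] by a
    factor which is incompatible with the factor [expR c] by which it multiplies
    the image of [P], these two measures being within [expR M] of each other. *)
Lemma cocycle_swap (A : set X) (M : R) n a b : measurable A ->
  (forall V, measurable V -> V `<=` A ->
     ((expR (- M))%:E * m V <= (prob P (T @^-1` V))%:E)%E /\
     ((prob P (T @^-1` V))%:E <= (expR M)%:E * m V)%E) ->
  \forall x \ae m, A x -> agree n (S x) a -> A (T (swap n a b (S x))) ->
    `|ln (delta (T (swap n a b (S x)), x)) -
      (logw p 0 n b - logw p 0 n a)| <= 2 * M + 1.
Proof.
move=> mA cmp; have [phi [N [fphi phiK mphi [mN N0] [phiE phiP]]]] := swap_aut n a b.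
set c := logw p 0 n b - logw p 0 n a.
pose del x := delta (phi x, x).
have mdel : measurable_fun [set: X] del.
  apply: (measurableT_comp (RN_measurable E_rn)).
  by apply: measurable_fun_pair => //; exact: measurable_id.
have mpre B : measurable B -> measurable (phi @^-1` B).
  by move=> mB; rewrite -[X in measurable X]setTI; exact: mphi.
have [N' [mN' N'0 hN']] := fphi.2.
pose D := ((A `\` (N `|` N')) `&` S @^-1` cylinder a n) `&` (phi @^-1` A).
have mD : measurable D.
  apply: measurableI; last exact: mpre.
  apply: measurableI.
    by apply: measurableD => //; exact: measurableU.
  by apply: measurable_preS; exact: measurable_cylinder.
have sandwich V : measurable V -> V `<=` D -> [/\ (m V < +oo)%E,
    ((expR (c - 2 * M))%:E * m V <= \int[m]_(x in V) (del x)%:E)%E &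
    (\int[m]_(x in V) (del x)%:E <= (expR (c + 2 * M))%:E * m V)%E].
  move=> mV VD.
  have VA : V `<=` A by move=> x /VD[[[]]].
  have pVA : phi @^-1` V `<=` A.
    by move=> x /VD[_]; rewrite /preimage /= phiK.
  have [lo hi] := cmp V mV VA.
  have [lo' hi'] := cmp _ (mpre _ mV) pVA.
  have VN : V `<=` ~` N by move=> x /VD[[[_ nN] _] _] Nx; apply: nN; left.
  have e := phiP V mV VN (fun x Vx => (VD x Vx).1.2).
  have rn := RN_derivative E_rn fphi mV.
  have im : phi @` V = phi @^-1` V.
    apply/seteqP; split => [_ [x Vx <-]|x Vx]; first by rewrite /preimage /= phiK.
    by exists (phi x).
  rewrite im in rn; rewrite -rn.
  have fin : (m V < +oo)%E.
    rewrite ltNge leye_eq; apply/negP => /eqP h; move: lo; rewrite h.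
    by rewrite gt0_muley ?lte_fin ?expR_gt0// leye_eq.
  have fin' : (m (phi @^-1` V) < +oo)%E.
    rewrite ltNge leye_eq; apply/negP => /eqP h; move: lo'; rewrite h.
    by rewrite gt0_muley ?lte_fin ?expR_gt0// leye_eq.
  have vE : m V = (fine (m V))%:E by rewrite fineK// ge0_fin_numE.
  have vE' : m (phi @^-1` V) = (fine (m (phi @^-1` V)))%:E.
    by rewrite fineK// ge0_fin_numE.
  split => //.
  - move: lo hi' {hi lo'}; rewrite e vE vE' -!EFinM !lee_fin.
    set u := fine _; set v := fine _; set w := prob _ _ => lo hi.
    rewrite -(ler_pM2l (expR_gt0 M)) mulrA -expRD.
    rewrite (_ : M + (c - 2 * M) = c - M); last lra.
    apply: le_trans hi; rewrite (expRD c (- M)) -mulrA ler_pM2l ?expR_gt0//.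
  - move: hi lo' {lo hi'}; rewrite e vE vE' -!EFinM !lee_fin.
    set u := fine _; set v := fine _; set w := prob _ _ => hi lo.
    rewrite -(ler_pM2l (expR_gt0 (- M))) mulrA -expRD.
    rewrite (_ : - M + (c + 2 * M) = c + M); last lra.
    apply: le_trans lo _; rewrite (expRD c M) -mulrA ler_pM2l ?expR_gt0//.
have mlt (I : set R) : measurable I -> measurable (D `&` del @^-1` I).
  move=> mI; apply: measurableI => //.
  by rewrite -[X in measurable X]setTI; exact: mdel.
pose V1 := D `&` del @^-1` `]-oo, expR (c - 2 * M - 1)].
pose V2 := D `&` del @^-1` `[expR (c + 2 * M + 1), +oo[.
have mV1 : measurable V1 by apply: mlt; exact: measurable_itv.
have mV2 : measurable V2 by apply: mlt; exact: measurable_itv.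
have E_phi x : D x -> E (phi x, x).
  move=> [[[_ nN] _] _]; apply: (eqv_sym E_eqv); apply: contrapT => h.
  by apply: nN; right; exact: hN'.
have mdelV V : measurable_fun V (fun x => (del x)%:E).
  by apply/measurable_EFinP; exact: measurable_funTS.
have gap (V : set X) (u v : R) : measurable V -> (m V < +oo)%E -> 0 < u -> u < v ->
    ((v%:E * m V) <= u%:E * m V)%E -> m V = 0%E.
  move=> mV fin u0 uv; have vE : m V = (fine (m V))%:E.
    by rewrite fineK// ge0_fin_numE.
  rewrite vE -!EFinM lee_fin => h; congr EFin.
  have w0 : 0 <= fine (m V) by exact: fine_ge0.
  apply: le_anti; rewrite w0 andbT.
  rewrite leNgt; apply/negP => w1.
  by move: h; rewrite ler_pM2r// leNgt uv.
have V10 : m V1 = 0%E.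
  have [fin h _] := sandwich _ mV1 (@subIsetl _ _ _).
  apply: (gap _ (expR (c - 2 * M - 1)) (expR (c - 2 * M))) => //.
  - exact: expR_gt0.
  - by rewrite ltr_expR; lra.
  apply: le_trans h _; rewrite -integral_cst//; apply: ge0_le_integral => //.
  - by move=> x [/E_phi/(RN_gt0 E_rn) h _]; rewrite lee_fin ltW.
  - by move=> x [_]; rewrite /preimage /= in_itv /= lee_fin.
have V20 : m V2 = 0%E.
  have [fin _ h] := sandwich _ mV2 (@subIsetl _ _ _).
  apply: (gap _ (expR (c + 2 * M)) (expR (c + 2 * M + 1))) => //.
  - exact: expR_gt0.
  - by rewrite ltr_expR; lra.
  apply: le_trans h; rewrite -integral_cst//; apply: ge0_le_integral => //.
  - by move=> x _; rewrite /cst lee_fin expR_ge0.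
  - by move=> x [_]; rewrite /preimage /= in_itv /= andbT lee_fin.
apply: (@negligibleS _ _ _ m ((N `|` N') `|` (V1 `|` V2))); last first.
  by apply: negligibleU; apply: negligibleU; exact/negligibleP.
move=> x /=; apply: contra_notP => /not_orP[nN /not_orP[nV1 nV2]].
have nNx : ~ N x by move=> Nx; apply: nN; left.
rewrite -(phiE _ nNx) => Ax Sx Aphi.
have Dx : D x by [].
have d0 : 0 < del x by apply: (RN_gt0 E_rn); exact: E_phi.
rewrite -/(del x) -/c ler_norml; apply/andP; split.
  rewrite leNgt; apply/negP => h; apply: nV1; split => //.
  rewrite /preimage /= in_itv /= -[del x](lnK (x := del x)) ?posrE// ler_expR.
  by lra.
rewrite leNgt; apply/negP => h; apply: nV2; split => //.
rewrite /preimage /= in_itv /= andbT -[X in _ <= X](lnK (x := del x)) ?posrE// ler_expR.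
by lra.
Qed.

(** The two cocycles differ by the coboundary of the logarithm of a density, which
    is bounded on a set of positive measure; [cocycle_swap] proves this for the
    countably many swaps at once. *)
Lemma bounded_transfer (A : set X) : measurable A -> m A != 0%E ->
  exists (A1 : set X) (M : R), [/\ measurable A1, A1 `<=` A, m A1 != 0%E,
    (forall x, A1 x -> matched x) &
    forall x x', A1 x -> A1 x' -> E (x, x') -> forall n,
      (forall i, (n <= i)%N -> S x i = S x' i) ->
      `|ln (delta (x', x)) - (logw p 0 n (S x') - logw p 0 n (S x))| <= M].
Proof.
move=> mA A0.
have [l lE] : exists l : probability X R, forall V, l V = P (T @^-1` V).
  have T_mfun : T \in mfun by rewrite inE; exact: mT.
  exists (distribution P (mfun_Sub T_mfun)) => V.
  by rewrite /distribution /pushforward mfun_valP.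
have lm V : measurable V -> m V = 0%E -> l V = 0%E.
  by move=> mV V0; rewrite lE; exact/nullT.
have ml V : measurable V -> l V = 0%E -> m V = 0%E.
  by move=> mV; rewrite lE => V0; exact/nullT.
have [A1 [M [mA1 A1A A10 M0 cmp]]] := comparable_on lm ml mA A0.
have cmp' V : measurable V -> V `<=` A1 ->
     ((expR (- M))%:E * m V <= (prob P (T @^-1` V))%:E)%E /\
     ((prob P (T @^-1` V))%:E <= (expR M)%:E * m V)%E.
  move=> mV VA; have [] := cmp V mV VA.
  by rewrite lE probE//; exact: measurable_preT.
have : \forall x \ae m, forall t : nat * seq nat * seq nat,
    A1 x -> agree t.1.1 (S x) (decode k t.1.2) ->
    A1 (T (swap t.1.1 (decode k t.1.2) (decode k t.2) (S x))) ->
    `|ln (delta (T (swap t.1.1 (decode k t.1.2) (decode k t.2) (S x)), x)) -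
      (logw p 0 t.1.1 (decode k t.2) - logw p 0 t.1.1 (decode k t.1.2))| <= 2 * M + 1.
  by apply: ae_forall_count => -[[n l1] l2] /=; exact: cocycle_swap.
move=> /(filterI ae_matched) [N [mN N0 hN]].
have hN' x : ~ N x -> _ := fun h => contrapT (fun h' => h (hN x h')).
exists (A1 `\` N), (2 * M + 1); split.
- exact: measurableD.
- by move=> x [/A1A].
- apply: contra A10 => /eqP h; apply/eqP/(negligibleP m mA1).
  apply: (@negligibleS _ _ _ m ((A1 `\` N) `|` N)).
    by move=> x Ax; case: (pselect (N x)) => Nx; [right|left].
  apply: negligibleU; apply/negligibleP => //; exact: measurableD.
- by move=> x [_ /hN'[]].
- move=> x x' [Ax Nx] [Ax' Nx'] xx' n tl.
  have [mx h] := hN' _ Nx.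
  have [l1 hl1] := decode_agree n (S x); have [l2 hl2] := decode_agree n (S x').
  have sw : swap n (decode k l1) (decode k l2) (S x) = S x'.
    rewrite swapE//; apply: functional_extensionality_dep => i; rewrite /merge.
    by case: ltnP => ni; [rewrite hl2|rewrite tl].
  have TSx' : T (S x') = x' by case: mx => _ h' _; case: (h' _ xx').
  have := h (n, l1, l2); rewrite /= sw TSx' => /(_ Ax hl1 Ax').
  rewrite (@eq_logw _ _ p 0 n (decode k l1) (S x)).
    rewrite (@eq_logw _ _ p 0 n (decode k l2) (S x'))//.
    by move=> i /andP[_ im]; rewrite hl2.
  by move=> i /andP[_ im]; rewrite hl1.
Qed.

End transfer.

(** * Windows of scales *)

Section windows.
Context (R : realType).
Implicit Types s t u K M : R.

Lemma mul2_expR s : 2 * expR s <= expR (s + 1).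
Proof.
rewrite expRD mulrC ler_pM2l ?expR_gt0//.
by have := expR_ge1Dx (1 : R); lra.
Qed.

Lemma mul8_expR s : 8 * expR s <= expR (s + 3).
Proof.
have := mul2_expR s; have := mul2_expR (s + 1); have := mul2_expR (s + 1 + 1).
by rewrite (_ : s + 1 + 1 + 1 = s + 3); lra.
Qed.

(** At a large scale, adding a bounded number keeps the sign and widens the
    window by at most one. *)
Lemma window_shift t u s K : `|u| <= K -> K + 1 <= expR (s - 4) ->
  expR (s - 3) < `|t| -> `|t| < expR (s + 3) ->
  (0 < t /\ expR (s - 4) < t + u < expR (s + 4)) \/
  (t < 0 /\ - expR (s + 4) < t + u < - expR (s - 4)).
Proof.
move=> uK Ks lo hi; have e0 := expR_gt0 (s - 4).
have e1 := mul2_expR (s - 4); rewrite (_ : s - 4 + 1 = s - 3) in e1; last lra.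
have e2 := mul2_expR (s + 3); rewrite (_ : s + 3 + 1 = s + 4) in e2; last lra.
have e3 : expR (s - 4) <= expR (s + 3) by rewrite ler_expR; lra.
move: uK; rewrite ler_norml => /andP[u1 u2].
case: (ltgtP t 0) lo hi => [t0|t0|->].
- by rewrite ltr0_norm// => lo hi; right; split => //; apply/andP; split; lra.
- by rewrite gtr0_norm// => lo hi; left; split => //; apply/andP; split; lra.
- by rewrite normr0; lra.
Qed.

Lemma window_perturb t u s M : `|t - u| <= M -> 2 * (`|M| + 1) <= expR s ->
  expR s <= `|u| -> `|u| <= 5 * expR s -> expR (s - 3) < `|t| < expR (s + 3).
Proof.
move=> tu Ms lo hi; have M0 := ler_norm M.
have t1 := ler_normD (t - u) u; rewrite subrK in t1.
have u1 := ler_normD (u - t) t; rewrite subrK (distrC u t) in u1.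
have e1 := mul8_expR s; have e2 := mul8_expR (s - 3); rewrite subrK in e2.
by have e0 := expR_gt0 s; apply/andP; split; lra.
Qed.

End windows.

(** * Measures on product and suspension spaces *)

Lemma lebesgue_measure_shift (R : realType) (c : R) (A : set R) :
  measurable A -> lebesgue_measure ((fun u => u + c) @^-1` A) = lebesgue_measure A.
Proof.
move=> mA.
have mf : measurable_fun [set: R] (fun u : R => u + c : measurableTypeR R).
  by apply: measurable_funD => //; exact: measurable_id.
have [l lE] := pushforward_measure (@lebesgue_measure R) mf.
rewrite -lE; apply/esym/lebesgue_measure_unique => // _ [[a b] _ <-].
rewrite lE /=.
have -> : (fun u => u + c) @^-1` `]a, b] = `]a - c, b - c]%classic.
  by apply/seteqP; split => u; rewrite /preimage /= !in_itv /= ltrBlDr lerBrDr.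
by rewrite !lebesgue_measure_itv /= !lte_fin ltrD2r -!EFinB opprB addrA subrK.
Qed.

Lemma limf_esup0 (R : realType) (f : R -> \bar R) (e : R) :
  limf_esup f +oo = 0%E -> 0 < e ->
  exists t, forall s, t <= s -> (f s < e%:E)%E.
Proof.
rewrite limf_esupE => f0 e0.
have : (ereal_inf [set ereal_sup (f @` V) | V in pinfty_nbhs R] < e%:E)%E.
  by rewrite f0 lte_fin.
move=> /ereal_inf_lt[_ [V [M [_ hM]] <-] h].
exists (M + 1) => s Ms; apply: le_lt_trans h; apply: ereal_sup_ubound.
by exists s => //; apply: hM; lra.
Qed.

Lemma mu_ext_cover d (Y : measurableType d) (R : realType)
    (nu : {measure set Y -> \bar R}) (A : set Y) (e : \bar R) :
  (mu_ext nu A < e)%E ->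
  exists C, [/\ measurable C, A `<=` C & (nu C <= e)%E].
Proof.
move=> /ereal_inf_lt[_ [B [mB AB] <-] h].
exists (\bigcup_j B j); split => //.
  exact: bigcupT_measurable.
apply: le_trans (ltW h); apply: generalized_Boole_inequality => //.
exact: bigcupT_measurable.
Qed.

Lemma fubini_null d (Y : measurableType d) (R : realType)
    (nu : {sigma_finite_measure set Y -> \bar R}) (B : set (Y * R)) :
  measurable B -> (forall t, nu (ysection B t) = 0%E) ->
  \forall y \ae nu, lebesgue_measure (xsection B y) = 0%E.
Proof.
move=> mB B0.
have mx : measurable_fun [set: Y] (fun y => lebesgue_measure (xsection B y)).
  exact: (measurable_fun_xsection (@lebesgue_measure R) mB).
have : (\int[nu]_y lebesgue_measure (xsection B y) = 0)%E.
  have := indic_fubini_tonelli nu (@lebesgue_measure R) mB.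
  rewrite indic_fubini_tonelli_FE// indic_fubini_tonelli_GE// => ->.
  by apply: integral0_eq => t _ /=; exact: B0.
move=> h0.
have : (\int[nu]_(y in setT) `|lebesgue_measure (xsection B y)| = 0)%E.
  by rewrite -[RHS]h0; apply: eq_integral => y _; rewrite gee0_abs.
move=> /(ae_eq_integral_abs nu measurableT mx).
by apply: filterS => y; exact.
Qed.

Section under.
Context (R : realType) d (X : measurableType d) dZ (Z : measurableType dZ).
Context (m : {measure set X -> \bar R}) (pi : X -> Z) (xi : Z -> R).
Hypothesis mpi : measurable_fun [set: X] pi.
Hypothesis mxi : measurable_fun [set: Z] xi.
Local Notation um := (under_measure (pushforward m pi) xi).

Lemma measurable_under_graph : measurable (under_graph xi).
Proof.
have -> : under_graph xi = (snd @^-1` `[0, +oo[) `&`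
    ((fun q : Z * R => xi q.1 - q.2) @^-1` `]0, +oo[).
  apply/seteqP; split => -[z u]; rewrite /under_graph /preimage /= !in_itv /= !andbT.
    by move=> /andP[-> h]; split => //; rewrite subr_gt0.
  by move=> [-> h]; rewrite -subr_gt0.
apply: measurableI.
  rewrite -[X in measurable X]setTI; apply: measurable_snd => //.
rewrite -[X in measurable X]setTI.
have mf : measurable_fun [set: Z * R] (fun q : Z * R => xi q.1 - q.2).
  apply: measurable_funB; last exact: measurable_snd.
  by apply: measurableT_comp => //; exact: measurable_fst.
exact: mf.
Qed.

(** The heights at which the vertical line over [x] meets [B] under the graph. *)
Definition column (B : set (Z * R)) x : set R :=
  [set u | B (pi x, u) /\ 0 <= u < xi (pi x)].

Lemma measurable_column B x : measurable B -> measurable (column B x).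
Proof.
move=> mB.
have : measurable (xsection (B `&` under_graph xi) (pi x)).
  apply: measurable_xsection; apply: measurableI => //.
  exact: measurable_under_graph.
by rewrite xsectionE.
Qed.

Lemma measurable_fun_column B : measurable B ->
  measurable_fun [set: X] (fun x => lebesgue_measure (column B x)).
Proof.
move=> mB.
have mBu : measurable (B `&` under_graph xi).
  by apply: measurableI => //; exact: measurable_under_graph.
have := measurable_fun_xsection (@lebesgue_measure R) mBu.
move=> /measurableT_comp => /(_ _ _ _ _ mpi).
by apply: eq_measurable_fun => x _ /=; rewrite xsectionE.
Qed.

Lemma under_measureE B : measurable B ->
  um B = (\int[m]_x lebesgue_measure (column B x))%E.
Proof.
move=> mB.
have mBu : measurable (B `&` under_graph xi).
  by apply: measurableI => //; exact: measurable_under_graph.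
have mx : measurable_fun [set: Z]
    (fun z => lebesgue_measure (xsection (B `&` under_graph xi) z)).
  exact: (measurable_fun_xsection (@lebesgue_measure R) mBu).
rewrite /under_measure /product_measure1.
rewrite ge0_integral_pushforward//.
by rewrite preimage_setT; apply: eq_integral => x _ /=; rewrite xsectionE.
Qed.

Lemma under_measure0P B : measurable B ->
  um B = 0%E <-> \forall x \ae m, lebesgue_measure (column B x) = 0%E.
Proof.
move=> mB; rewrite under_measureE//; have mf := measurable_fun_column mB.
have -> : (\int[m]_x lebesgue_measure (column B x) =
    \int[m]_(x in setT) `|lebesgue_measure (column B x)|)%E.
  by apply: eq_integral => x _; rewrite gee0_abs.
rewrite (ae_eq_integral_abs m measurableT mf); split.
  by apply: filterS => x; exact.
by apply: filterS => x h _.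
Qed.

End under.

(** * Flows built under a function *)

Section climbing.
Context (R : realType) (Z : Type) (T Ti : Z -> Z) (xi : Z -> R).

Definition birkhoff n z : R := \sum_(j < n) xi (iter j T z).

Lemma birkhoffS n z : birkhoff n.+1 z = xi z + birkhoff n (T z).
Proof.
rewrite /birkhoff big_ord_recl; congr (_ + _); apply: eq_bigr => j _.
by rewrite lift0 iterSr.
Qed.

(** Applied twice, this determines the floor on which a point lies from its total
    height. *)
Lemma climb_le (x : nat -> R) (v : R) n n' : (forall j, 0 < x j) ->
  0 <= v - \sum_(j < n) x j -> v - \sum_(j < n') x j < x n' -> (n <= n')%N.
Proof.
move=> x0 hn hn'; rewrite leqNgt; apply/negP => nn'.
have : \sum_(j < n'.+1) x j <= \sum_(j < n) x j.
  rewrite -!(big_mkord xpredT x) (@big_cat_nat _ _ _ n'.+1 0 n) //=.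
  by rewrite lerDl; apply: sumr_ge0 => j _; exact: ltW.
by rewrite big_ord_recr /=; lra.
Qed.

Lemma forward_unique z (v : R) n n' : (forall j, 0 < xi (iter j T z)) ->
  0 <= v - birkhoff n z < xi (iter n T z) ->
  0 <= v - birkhoff n' z < xi (iter n' T z) -> n = n'.
Proof.
move=> x0 /andP[a b] /andP[a' b']; apply/eqP; rewrite eqn_leq.
by apply/andP; split;
  apply: (@climb_le (fun j => xi (iter j T z)) v).
Qed.

Hypothesis TTi : forall z, T (Ti z) = z.

Lemma birkhoff_back n z :
  birkhoff n (iter n Ti z) = \sum_(j < n) xi (iter j.+1 Ti z).
Proof.
elim: n => [|n IH]; first by rewrite /birkhoff !big_ord0.
by rewrite birkhoffS big_ord_recr /= TTi IH addrC.
Qed.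

Lemma iter_TTi n z : iter n T (iter n Ti z) = z.
Proof. by elim: n z => // n IH z; rewrite iterSr iterS TTi IH. Qed.

Lemma backward_unique z (v : R) n n' : (forall j, 0 < xi (iter j Ti z)) ->
  0 <= v + birkhoff n (iter n Ti z) < xi (iter n Ti z) ->
  0 <= v + birkhoff n' (iter n' Ti z) < xi (iter n' Ti z) -> n = n'.
Proof.
move=> x0; rewrite !birkhoff_back => /andP[a b] /andP[a' b'].
have le i j : 0 <= v + \sum_(l < i) xi (iter l.+1 Ti z) ->
    v + \sum_(l < j) xi (iter l.+1 Ti z) < xi (iter j Ti z) -> (j <= i)%N.
  move=> hi hj; rewrite leqNgt; apply/negP => ij.
  have : \sum_(l < i) xi (iter l.+1 Ti z) + xi (iter j Ti z) <=
      \sum_(l < j) xi (iter l.+1 Ti z).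
    case: j ij hj => // j ij hj; rewrite big_ord_recr /= lerD2r.
    rewrite -!(big_mkord xpredT (fun l => xi (iter l.+1 Ti z))).
    rewrite (@big_cat_nat _ _ _ i 0 j) //= lerDl.
    by apply: sumr_ge0 => l _; exact: ltW (x0 l.+1).
  by lra.
by apply/eqP; rewrite eqn_leq !le.
Qed.

End climbing.

Section reach.
Context (R : realType) (X Z : Type) (E : set (X * X)) (delta : X * X -> R).
Context (pi : X -> Z) (T : Z -> Z) (xi : Z -> R).
Hypothesis E_refl : forall x, E (x, x).
Hypothesis E_sym : forall x y, E (x, y) -> E (y, x).
Hypothesis E_trans : forall x y z, E (x, y) -> E (y, z) -> E (x, z).
Hypothesis d_gt0 : forall q, E q -> 0 < delta q.
Hypothesis dM : forall x y z, E (x, y) -> E (y, z) ->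
  delta (x, z) = delta (x, y) * delta (y, z).
Hypothesis lac : lacunary E delta.

Definition regular x := is_min (log_jumps E delta x) (xi (pi x)) /\
  forall x', E (x, x') -> ln (delta (x', x)) = xi (pi x) -> T (pi x) = pi x'.

Lemma ln_delta x y z : E (x, y) -> E (y, z) ->
  ln (delta (x, z)) = ln (delta (x, y)) + ln (delta (y, z)).
Proof. by move=> xy yz; rewrite (dM xy yz) lnM ?posrE ?d_gt0. Qed.

Lemma ln_delta_sym x y : E (x, y) -> ln (delta (x, y)) = - ln (delta (y, x)).
Proof.
move=> xy; have yx := E_sym xy.
have := ln_delta xy yx; have := ln_delta (E_refl x) (E_refl x).
by lra.
Qed.

(** The orbit of [x] climbs from jump to jump towards [x']: each smallest jump is
    at most the remaining height, and by lacunarity it is bounded below, so that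
    finitely many steps suffice. *)
Lemma reach x x' : (forall y, E (x, y) -> regular y) -> E (x, x') ->
  0 < ln (delta (x', x)) ->
  exists n, iter n T (pi x) = pi x' /\
    birkhoff T xi n (pi x) = ln (delta (x', x)).
Proof.
have [e e0 he] := lac.
move=> reg xx' t0.
have [N] : exists N : nat, ln (delta (x', x)) <= N%:R * e.
  exists (Num.bound (ln (delta (x', x)) / e)).
  rewrite -ler_pdivrMr//; apply: ltW; apply: archi_boundP.
  by apply: divr_ge0; exact: ltW.
elim: N x reg xx' t0 => [|N IH] x reg xx' t0; first by rewrite mul0r; lra.
have [[[xi0 [x1 xx1 x1E]] xmin] xT] := reg x (E_refl x).
have : xi (pi x) <= ln (delta (x', x)).
  by apply: xmin; split => //; exists x' => //; exact: E_sym.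
rewrite le_eqVlt => /orP[/eqP h|h] tN.
  exists 1%N; rewrite /= (xT x')//; split => //.
  by rewrite /birkhoff big_ord1.
have xx1' := E_sym xx1.
have x1x' := E_trans xx1 xx'.
have tE : ln (delta (x', x)) = ln (delta (x', x1)) + xi (pi x).
  by rewrite x1E; apply: ln_delta => //; exact: E_sym.
have e1 : e < xi (pi x).
  case: (he (x1, x) xx1); first by rewrite -x1E => h0; rewrite h0 ltxx in xi0.
  by rewrite -x1E gtr0_norm.
have reg1 y : E (x1, y) -> regular y.
  by move=> x1y; apply: reg; exact: E_trans xx1' x1y.
have t1 : 0 < ln (delta (x', x1)) by lra.
have tN1 : ln (delta (x', x1)) <= N%:R * e.
  by move: tN; rewrite -natr1 mulrDl mul1r tE; lra.
have [n [n1 n2]] := IH x1 reg1 x1x' t1 tN1.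
exists n.+1; rewrite iterSr (xT x1)// n1; split => //.
by rewrite birkhoffS (xT x1)// n2 tE addrC.
Qed.

End reach.

(** * From the associated flow to the equivalence relation *)

Section flow.
Context (R : realType) d (X : measurableType d)
  (m : {sigma_finite_measure set X -> \bar R})
  (E : set (X * X)) (delta : X * X -> R).
Hypothesis E_eqv : countable_measured_eqv m E.
Hypothesis E_rn : RN_cocycle m E delta.
Hypothesis lac : lacunary E delta.
Context dZ (Z : measurableType dZ) (pi : X -> Z) (xi : Z -> R) (T Ti : Z -> Z).
Local Notation mu0 := (pushforward m pi).
Hypothesis mpi : measurable_fun [set: X] pi.
Hypothesis mxi : measurable_fun [set: Z] xi.
Hypothesis xi_min : {ae m, forall x, is_min (log_jumps E delta x) (xi (pi x))}.
Hypothesis TK : cancel T Ti.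
Hypothesis TiK : cancel Ti T.
Hypothesis mT : measurable_fun [set: Z] T.
Hypothesis mTi : measurable_fun [set: Z] Ti.
Hypothesis T0 : forall A, measurable A -> (mu0 (T @^-1` A) = 0%E <-> mu0 A = 0%E).
Hypothesis Tpi : {ae m, forall x, forall x', E (x, x') ->
  ln (delta (x', x)) = xi (pi x) -> T (pi x) = pi x'}.
Context dY (Y : measurableType dY) (nu : {sigma_finite_measure set Y -> \bar R})
  (F : R -> Y -> Y) (Psi : Y -> Z * R) (Phi : Z * R -> Y).
Hypothesis F_flow : measurable_flow nu F.
Local Notation um := (under_measure mu0 xi).
Local Notation ug := (under_graph xi).
Hypothesis mPsi : measurable_fun [set: Y] Psi.
Hypothesis mPhi : measurable_fun [set: Z * R] Phi.
Hypothesis PhiPsi : {ae nu, forall y, Phi (Psi y) = y}.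
Hypothesis PsiPhi : {ae um, forall q, Psi (Phi q) = q}.
Hypothesis nuPsi : forall B, measurable B -> (nu (Psi @^-1` B) = 0%E <-> um B = 0%E).
Hypothesis conj : forall t, {ae nu, forall y, flow_under T xi t (Psi y) (Psi (F t y))}.

Lemma ae_regular :
  \forall x \ae m, forall x', E (x, x') -> regular E delta pi T xi x'.
Proof.
apply: ae_class => //; move: xi_min Tpi; apply: filterS2 => x h1 h2; by split.
Qed.

Lemma null_Phi (B : set Y) : measurable B ->
  (um (Phi @^-1` B) = 0%E <-> nu B = 0%E).
Proof.
move=> mB; have [N [mN N0 hN]] := PhiPsi.
have hP y : ~ N y -> Phi (Psi y) = y by move=> nN; apply: contrapT => /hN.
have mB1 := mpreimage mPhi mB; have mB2 := mpreimage mPsi mB1.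
rewrite -nuPsi//; split => B0.
  apply/(negligibleP nu mB); apply: (@negligibleS _ _ _ nu
    (Psi @^-1` (Phi @^-1` B) `|` N)).
    move=> y By; case: (pselect (N y)) => Ny; first by right.
    by left; rewrite /preimage /= hP.
  by apply: negligibleU; exact/negligibleP.
apply/(negligibleP nu mB2); apply: (@negligibleS _ _ _ nu (B `|` N)).
  move=> y; rewrite /preimage /=; case: (pselect (N y)) => Ny; first by right.
  by rewrite hP//; left.
by apply: negligibleU; exact/negligibleP.
Qed.

Lemma measurable_iter (f : Z -> Z) n : measurable_fun [set: Z] f ->
  measurable_fun [set: Z] (iter n f).
Proof.
move=> mf; elim: n => [|n IH]; first exact: measurable_id.
exact: (measurableT_comp mf IH).
Qed.

Lemma measurable_birkhoff n : measurable_fun [set: Z] (birkhoff T xi n).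
Proof.
elim: n => [|n IH].
  have -> : birkhoff T xi 0 = cst 0.
    by apply/funext => z; rewrite /birkhoff big_ord0.
  exact: measurable_cst.
have -> : birkhoff T xi n.+1 = (fun z => xi z + birkhoff T xi n (T z)).
  by apply/funext => z; rewrite birkhoffS.
by apply: measurable_funD => //; exact: (measurableT_comp IH mT).
Qed.

Definition positive_orbit z :=
  forall j, 0 < xi (iter j T z) /\ 0 < xi (iter j Ti z).

Lemma ae_positive_orbit : \forall y \ae nu, positive_orbit (Psi y).1.
Proof.
pose L := xi @^-1` `]-oo, 0].
have mL : measurable L by apply: mpreimage => //; exact: measurable_itv.
have L0 : mu0 L = 0%E.
  apply/(negligibleP m (mpreimage mpi mL)).
  apply: (negligibleS _ xi_min) => x; rewrite /L /preimage /= in_itv /= => h [[h0 _] _].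
  by move: h0; rewrite ltNge h.
have Ti0 A : measurable A -> mu0 A = 0%E -> mu0 (Ti @^-1` A) = 0%E.
  move=> mA A0; apply/T0; first exact: mpreimage.
  rewrite (_ : T @^-1` _ = A)//.
  by apply/seteqP; split => z; rewrite /preimage /= TK.
have iter0 (f : Z -> Z) j : measurable_fun [set: Z] f ->
    (forall A, measurable A -> mu0 A = 0%E -> mu0 (f @^-1` A) = 0%E) ->
    mu0 (iter j f @^-1` L) = 0%E.
  move=> mf f0; elim: j => // j IH.
  have -> : iter j.+1 f @^-1` L = f @^-1` (iter j f @^-1` L).
    by apply/seteqP; split => z; rewrite /preimage /= -iterSr.
  by apply: f0 => //; apply: mpreimage => //; exact: measurable_iter.
have aej (f : Z -> Z) j : measurable_fun [set: Z] f ->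
    mu0 (iter j f @^-1` L) = 0%E -> \forall y \ae nu, 0 < xi (iter j f (Psi y).1).
  move=> mf h0.
  have mI : measurable (iter j f @^-1` L) by apply: mpreimage => //; exact: measurable_iter.
  have mIf : measurable ((fst : Z * R -> Z) @^-1` (iter j f @^-1` L)).
    by apply: mpreimage => //; exact: measurable_fst.
  exists (Psi @^-1` (fst @^-1` (iter j f @^-1` L))); split.
  - exact: mpreimage.
  - apply/nuPsi => //; apply/(under_measure0P _ mpi mxi) => //.
    exists (pi @^-1` (iter j f @^-1` L)); split => //; first exact: mpreimage.
    move=> x /=; apply: contra_notP => nL.
    rewrite (_ : column _ _ _ _ = set0) ?measure0//.
    by apply/seteqP; split => // u [].
  - by move=> y /= /negP; rewrite -leNgt /L /preimage /= in_itv.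
have h1 : \forall y \ae nu, forall j, 0 < xi (iter j T (Psi y).1).
  apply: ae_foralln => j; apply: aej => //; apply: iter0 => // A mA A0.
  exact/T0.
have h2 : \forall y \ae nu, forall j, 0 < xi (iter j Ti (Psi y).1).
  by apply: ae_foralln => j; apply: aej => //; exact: iter0.
by move: h1 h2; apply: filterS2 => y h1 h2 j; split.
Qed.

(** The candidate for the point reached at time [t] when the base point moves
    by [U] and the height is corrected by [w]. *)
Definition target (U : Z -> Z) (w : Z -> R) y (t : R) : Z * R :=
  (U (Psi y).1, (Psi y).2 + t - w (Psi y).1).

(** The point of the orbit reached at time [t] lies on the only floor that
    contains its height; the exceptional null set depends on [t]. *)
Lemma forward_target n t : 0 <= t -> \forall y \ae nu,
  ug (target (iter n T) (birkhoff T xi n) y t) ->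
  Psi (F t y) = target (iter n T) (birkhoff T xi n) y t.
Proof.
move=> t0; have := conj t; rewrite /flow_under t0 => ct.
move: ct ae_positive_orbit; apply: filterS2 => y [_ ug' [n' [e1 e2]]] pos ug2.
have nn' : n = n'.
  apply: (@forward_unique _ _ T xi (Psi y).1 ((Psi y).2 + t)) => //.
    by move=> j; have [] := pos j.
  by move: ug'; rewrite /under_graph /= e1 e2.
by rewrite [LHS]surjective_pairing e1 e2 /target nn'.
Qed.

Lemma backward_target n t : t < 0 -> \forall y \ae nu,
  ug (target (iter n Ti) (fun z => - birkhoff T xi n (iter n Ti z)) y t) ->
  Psi (F t y) = target (iter n Ti) (fun z => - birkhoff T xi n (iter n Ti z)) y t.
Proof.
move=> t0; have := conj t; rewrite /flow_under leNgt t0 /= => ct.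
move: ct ae_positive_orbit; apply: filterS2 => y [ug' _ [n' [e1 e2]]] pos ug2.
have e1' : (Psi (F t y)).1 = iter n' Ti (Psi y).1.
  by rewrite e1 (iter_TTi TK).
have e2' : (Psi (F t y)).2 =
    (Psi y).2 + t + birkhoff T xi n' (iter n' Ti (Psi y).1).
  by rewrite -e1' e2 /birkhoff; lra.
have nn' : n = n'.
  apply: (@backward_unique _ _ T Ti xi TiK (Psi y).1 ((Psi y).2 + t)) => //.
  - by move=> j; have [] := pos j.
  - by move: ug2; rewrite /under_graph /target /= opprK.
  - by move: ug'; rewrite /under_graph /= e1' e2'.
by rewrite [LHS]surjective_pairing e1' e2' /target nn' opprK.
Qed.

Section escape.
Context (A : set Y) (U : Z -> Z) (w : Z -> R) (I : interval R).
Hypothesis mA : measurable A.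
Hypothesis mU : measurable_fun [set: Z] U.
Hypothesis mw : measurable_fun [set: Z] w.
Hypothesis UF : forall t, t \in I -> \forall y \ae nu,
  ug (target U w y t) -> Psi (F t y) = target U w y t.

(** The pairs [(y, t)] for which the explicit formula predicts a point of [A]
    wrongly.  This set is measurable by construction, whereas the graph of the
    suspension flow involves equality in the quotient space. *)
Definition escape : set (Y * R) := [set q | [/\ q.2 \in I,
  ug (target U w q.1 q.2), A (Phi (target U w q.1 q.2)) & ~ A (F q.2 q.1)]].

Lemma measurable_escape : measurable escape.
Proof.
have mt : measurable_fun [set: Y * R] (fun q : Y * R => target U w q.1 q.2).
  have m1 : measurable_fun [set: Y * R] (fun q : Y * R => (Psi q.1).1).
    apply: (measurableT_comp measurable_fst).
    by apply: (measurableT_comp mPsi); exact: measurable_fst.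
  have m2 : measurable_fun [set: Y * R] (fun q : Y * R => (Psi q.1).2).
    apply: (measurableT_comp measurable_snd).
    by apply: (measurableT_comp mPsi); exact: measurable_fst.
  apply: measurable_fun_pair; first exact: (measurableT_comp mU m1).
  apply: measurable_funB; last exact: (measurableT_comp mw m1).
  by apply: measurable_funD => //; exact: measurable_snd.
have -> : escape = ((snd @^-1` [set` I]) `&`
    ((fun q : Y * R => target U w q.1 q.2) @^-1` (ug `&` Phi @^-1` A))) `&`
    ((fun q : Y * R => F q.2 q.1) @^-1` (~` A)).
  by apply/seteqP; split => q [] => [h1 h2 h3 h4|[h1 [h2 h3]] h4].
apply: measurableI; last first.
  by apply: mpreimage; [exact: (flow_measurable F_flow)|exact: measurableC].
apply: measurableI.
  by apply: mpreimage; [exact: measurable_snd|exact: measurable_itv].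
apply: mpreimage => //; apply: measurableI; first exact: measurable_under_graph.
exact: mpreimage.
Qed.

(** By Fubini, a null set of points for each time becomes, for almost every point,
    a null set of times. *)
Lemma ae_escape : \forall y \ae nu, lebesgue_measure (xsection escape y) = 0%E.
Proof.
apply: fubini_null; first exact: measurable_escape.
move=> t; have my : measurable (ysection escape t).
  by apply: measurable_ysection; exact: measurable_escape.
apply/(negligibleP nu my).
have [tI|tI] := boolP (t \in I); last first.
  apply: (@negligibleS _ _ _ nu set0); last exact: negligible_set0.
  by move=> y; rewrite ysectionE => -[/=]; rewrite (negbTE tI).
have [N [mN N0 hN]] := PhiPsi.
have FN : nu.-negligible (F t @^-1` N).
  have [psi [_ _ mF _ F0]] := flow_aut F_flow t.
  by apply/(negligibleP nu (mpreimage mF mN)); exact/F0.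
have [N' [mN' N'0 hN']] := UF tI.
apply: (@negligibleS _ _ _ nu (F t @^-1` N `|` N')); last first.
  by apply: negligibleU => //; exact/negligibleP.
move=> y; rewrite ysectionE => -[/= _ h2 h3 h4].
case: (pselect (N' y)) => Ny'; first by right.
left; apply: contrapT => nN; apply: h4.
have e : Psi (F t y) = target U w y t.
  by apply: contrapT => h; apply: Ny'; apply: hN' => /= /(_ h2).
have <- : Phi (Psi (F t y)) = F t y by apply: contrapT => /hN.
by rewrite e.
Qed.

End escape.

Definition returns (A0 : set X) (s e : R) x := exists x', [/\ A0 x', E (x, x') &
  expR (s - e) < `|ln (delta (x', x))| < expR (s + e)].

(** Property B passes from the associated flow to the equivalence relation.  The
    set [A0] consists of the points whose column meets the returning set [A] in
    positive measure below a level [K].  If [x] and [x'] lie in [A0] and in the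
    same class, the flow leads [(pi x, u)] to [(pi x', u')] in the time
    [ln (delta (x', x)) + (u' - u)], so a return of [x] at scale [s] is a return
    of [(pi x, u)] to [A] at nearly the same scale.  When the return sets of the
    flow at scales [s j] have summable measures, almost every point lies in
    finitely many of them. *)
Lemma property_B_base : property_B nu F ->
  exists (A0 : set X) (tau : nat -> R), [/\ measurable A0, m A0 != 0%E &
    forall s : nat -> R, (forall j, tau j <= s j) ->
      \forall x \ae m, A0 x ->
        exists j0, forall j, (j0 <= j)%N -> ~ returns A0 (s j) 3 x].
Proof.
move=> [A [mA A0 limA]].
have mPA := mpreimage mPhi mA.
pose BK (K : nat) : set (Z * R) := Phi @^-1` A `&` snd @^-1` `]-oo, K%:R].
have mBK K : measurable (BK K).
  apply: measurableI => //; apply: mpreimage; first exact: measurable_snd.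
  exact: measurable_itv.
have [K BK0] : exists K, um (BK K) != 0%E.
  apply: contrapT => nK.
  have h K : um (BK K) = 0%E by apply: contrapT => h; apply: nK; exists K; exact/eqP.
  suff : nu A = 0%E by move=> h0; rewrite h0 ltxx in A0.
  apply/null_Phi => //; apply/(under_measure0P _ mpi mxi) => //.
  have : \forall x \ae m, forall K, lebesgue_measure (column pi xi (BK K) x) = 0%E.
    by apply: ae_foralln => K; apply/(under_measure0P _ mpi mxi).
  apply: filterS => x hx.
  have mc : measurable (column pi xi (Phi @^-1` A) x) by exact: measurable_column.
  apply/(negligibleP (@lebesgue_measure R) mc).
  apply: (@negligibleS _ _ _ (@lebesgue_measure R) (\bigcup_K column pi xi (BK K) x)); last first.
    apply: negligible_bigcup => K.
    have mcK : measurable (column pi xi (BK K) x) by exact: measurable_column.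
    by apply/(negligibleP (@lebesgue_measure R) mcK); exact: hx.
  move=> u [Au /andP[u0 uxi]]; exists (Num.bound u) => //; split; last by rewrite u0.
  by split => //=; rewrite in_itv /= ltW// archi_boundP.
pose C0 x := column pi xi (BK K) x.
have mC0 x : measurable (C0 x) by exact: measurable_column.
pose A1 := (fun x => lebesgue_measure (C0 x)) @^-1` (~` [set 0%E]).
have mA1 : measurable A1.
  apply: mpreimage; first exact: measurable_fun_column.
  by apply: measurableC; exact: emeasurable_set1.
have A10 : m A1 != 0%E.
  apply: contra BK0 => /eqP h; apply/eqP/(under_measure0P _ mpi mxi) => //.
  by exists A1; split.
have e_gt0 j : 0 < 1 / (2 ^ j.+1)%:R :> R by rewrite divr_gt0// ltr0n expn_gt0.
have four : 0 < (4 : R) by lra.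
have [tau0 tau0P] := choice (fun j => limf_esup0 (limA 4 four) (e_gt0 j)).
pose tau j := Num.max (tau0 j) (ln (K%:R + 1) + 4).
exists A1, tau; split => // s taus.
have tau_ge j : tau0 j <= tau j by rewrite /tau le_max lexx.
have coverP j := mu_ext_cover (tau0P j (s j)
  (le_trans (tau_ge j) (taus j))).
have [C CP] := choice coverP.
pose L := lim_sup_set C.
have mC j : measurable (C j) by case: (CP j).
have L0 : nu L = 0%E.
  apply: lim_sup_set_cvg0 => //.
  apply: (@le_lt_trans _ _ (\sum_(j <oo) (1 / (2 ^ j.+1)%:R)%:E)%E).
    by apply: lee_nneseries => // j _; have [_ _] := CP j.
  by apply: le_lt_trans (epsilon_trick0 xpredT ler01) _; rewrite ltry.
have mL : measurable L by apply: bigcapT_measurable => j; exact: bigcup_measurable.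
pose wf n := birkhoff T xi n.
pose wb n z := - birkhoff T xi n (iter n Ti z).
have mwf n : measurable_fun [set: Z] (wf n) := measurable_birkhoff n.
have mwb n : measurable_fun [set: Z] (wb n).
  apply: measurable_funN; apply: (measurableT_comp (mwf n)).
  exact: measurable_iter.
have ae1 : \forall y \ae nu, forall n,
    lebesgue_measure (xsection (escape A (iter n T) (wf n) `[0, +oo[) y) = 0%E.
  apply: ae_foralln => n; apply: ae_escape => //; first exact: measurable_iter.
  by move=> t; rewrite in_itv /= andbT => t0; exact: forward_target.
have ae2 : \forall y \ae nu, forall n,
    lebesgue_measure (xsection (escape A (iter n Ti) (wb n) `]-oo, 0[) y) = 0%E.
  apply: ae_foralln => n; apply: ae_escape => //; first exact: measurable_iter.
  by move=> t; rewrite in_itv /= => t0; exact: backward_target.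
have ae3 : \forall y \ae nu, ~ L y.
  by exists L; split => // y /= /contrapT.
have [N [mN N0 hN]] := filterI (filterI ae1 ae2) ae3.
have [N' [mN' N'0 hN']] := PsiPhi.
have colN : \forall x \ae m, lebesgue_measure (column pi xi (Phi @^-1` N) x) = 0%E.
  apply/(under_measure0P _ mpi mxi); first exact: mpreimage.
  by apply/null_Phi.
have colN' : \forall x \ae m, lebesgue_measure (column pi xi N' x) = 0%E.
  exact/(under_measure0P _ mpi mxi).
move: colN colN' ae_regular; apply: filterS3 => x cN cN' reg A1x.
(* a height over [x] which avoids all the exceptional null sets *)
have [u [Cu nNu nN'u]] : exists u, [/\ C0 x u, ~ N (Phi (pi x, u)) & ~ N' (pi x, u)].
  apply: contrapT => h; apply: A1x => /=.
  have mNx : measurable (column pi xi (Phi @^-1` N) x).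
    by apply: measurable_column => //; exact: mpreimage.
  have mN'x : measurable (column pi xi N' x) by exact: measurable_column.
  apply/(negligibleP (@lebesgue_measure R) (mC0 x)).
  apply: (@negligibleS _ _ _ (@lebesgue_measure R)
    (column pi xi (Phi @^-1` N) x `|` column pi xi N' x)).
    move=> u Cu; apply: contrapT => /not_orP[n1 n2]; apply: h; exists u.
    by split => // h; [apply: n1|apply: n2]; split => //; case: Cu.
  by apply: negligibleU; exact/negligibleP.
pose y := Phi (pi x, u).
have Psiy : Psi y = (pi x, u) by apply: contrapT => h; apply: nN'u; exact: hN'.
have [[esc1 esc2] nLy] : ((forall n, lebesgue_measure
      (xsection (escape A (iter n T) (wf n) `[0, +oo[) y) = 0%E) /\
    (forall n, lebesgue_measure
      (xsection (escape A (iter n Ti) (wb n) `]-oo, 0[) y) = 0%E)) /\ ~ L y.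
  by apply: contrapT => h; apply: nNu; exact: hN.
have [j0 hj0] : exists j0, forall j, (j0 <= j)%N -> ~ C j y.
  apply: contrapT => h; apply: nLy => j0 _; apply: contrapT => h2; apply: h.
  by exists j0 => j jj Cj; apply: h2; exists j.
exists j0 => j jj0 [x' [A1x' xx' /andP[lo hi]]].
apply: (hj0 j jj0); have [_ + _] := CP j; apply.
have [[Ay uK] /andP[u0 uxi]] : C0 x u by [].
rewrite /= in_itv /= in uK.
set t := ln (delta (x', x)) in lo hi.
have x'x := eqv_sym E_eqv xx'.
have shift_bound u' : C0 x' u' -> `|u' - u| <= K%:R.
  move=> [[_]]; rewrite /= in_itv /= => u'K /andP[u'0 _].
  by rewrite ler_norml; move: u0 uK u'0 u'K; lra.
have Klt : K%:R + 1 <= expR (s j - 4).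
  have K1 : 0 < K%:R + 1 :> R by rewrite ltr_pwDr.
  rewrite -[X in X <= _](lnK (x := K%:R + 1)) ?posrE// ler_expR lerBrDr.
  by apply: le_trans (taus j); rewrite /tau le_max lexx orbT.
(* a time near [t] at which the flow brings [y] back to [A] suffices *)
suff [u' [C0u' Au']] : exists u', C0 x' u' /\ A (F (u' + (t - u)) y).
  split => //; exists (u' + (t - u)) => //.
  rewrite (addrCA u'); case: (window_shift (shift_bound _ C0u') Klt lo hi) => -[_ h].
    by left; rewrite /= in_itv /=.
  by right; rewrite /= in_itv /=.
(* the times predicted by the formula for [U] and [w] and lost to [escape] are
   negligible, while the column over [x'] is not *)
have hit (U : Z -> Z) (w : Z -> R) (I : interval R) : 
    measurable_fun [set: Z] U -> measurable_fun [set: Z] w ->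
    lebesgue_measure (xsection (escape A U w I) y) = 0%E ->
    (forall u', C0 x' u' -> u' + (t - u) \in I /\
      target U w y (u' + (t - u)) = (pi x', u')) ->
    exists u', C0 x' u' /\ A (F (u' + (t - u)) y).
  move=> mU mw h0 hC; apply: contrapT => h; apply: A1x' => /=.
  have msec : measurable (xsection (escape A U w I) y).
    by apply: measurable_xsection; exact: measurable_escape.
  apply/(negligibleP (@lebesgue_measure R) (mC0 x')).
  exists ((fun v => v + (t - u)) @^-1` xsection (escape A U w I) y); split.
  - apply: mpreimage => //; apply: measurable_funD => //; exact: measurable_id.
  - by rewrite [LHS]lebesgue_measure_shift.
  - move=> u' Cu'; have [tI tE] := hC _ Cu'.
    rewrite /preimage /= xsectionE /escape /preimage /=.
    have [[Au' _] ugu'] := Cu'; rewrite tE; split => // AF.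
    by apply: h; exists u'.
case: (ltP 0 t) => ht.
  have [n [n1 n2]] : exists n, iter n T (pi x) = pi x' /\
      birkhoff T xi n (pi x) = t.
    by apply: (@reach _ _ _ E delta pi T xi (eqv_refl E_eqv) (eqv_sym E_eqv)
      (eqv_trans E_eqv) (RN_gt0 E_rn) (RN_cocycle_eq E_rn) lac).
  apply: (hit (iter n T) (wf n) `[0, +oo[) => //; first exact: measurable_iter.
  move=> u' Cu'; rewrite in_itv /= andbT (addrCA u'); split.
    case: (window_shift (shift_bound _ Cu') Klt lo hi) => -[t0 /andP[h _]].
      exact: ltW (lt_trans (expR_gt0 _) h).
    by rewrite ltNge ltW// in t0.
  rewrite /target Psiy /= /wf n1 n2; congr (_, _); lra.
have tE : ln (delta (x, x')) = - t := ln_delta_sym (eqv_refl E_eqv)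
  (eqv_sym E_eqv) (RN_gt0 E_rn) (RN_cocycle_eq E_rn) xx'.
have z0 : `|0 : R| <= K%:R by rewrite normr0.
have tneg : t < 0.
  case: (window_shift z0 Klt lo hi) => -[t0 _]; last exact: t0.
  by rewrite ltNge ht in t0.
have [n [n1 n2]] : exists n, iter n T (pi x') = pi x /\
    birkhoff T xi n (pi x') = ln (delta (x, x')).
  apply: (@reach _ _ _ E delta pi T xi (eqv_refl E_eqv) (eqv_sym E_eqv)
    (eqv_trans E_eqv) (RN_gt0 E_rn) (RN_cocycle_eq E_rn) lac) => //.
    by move=> z x'z; apply: reg; exact: (eqv_trans E_eqv) xx' x'z.
  by rewrite tE oppr_gt0.
apply: (hit (iter n Ti) (wb n) `]-oo, 0[) => //; first exact: measurable_iter.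
move=> u' Cu'; rewrite in_itv /= (addrCA u'); split.
  case: (window_shift (shift_bound _ Cu') Klt lo hi) => -[t0 /andP[_ h]].
    by rewrite ltNge ht in t0.
  by apply: lt_trans h _; rewrite oppr_lt0 expR_gt0.
rewrite /target Psiy /= /wb -n1 (iter_TTi TK) n2 tE; congr (_, _); lra.
Qed.

End flow.

(** * Conclusion *)

Section assembly.
Context (R : realType) d (X : measurableType d).

Lemma ae_exists (m : {measure set X -> \bar R}) (A : set X) (Q : X -> Prop) :
  measurable A -> m A != 0%E -> (\forall x \ae m, Q x) -> exists2 x, A x & Q x.
Proof.
move=> mA A0 aeQ; apply: contrapT => h; move/eqP: A0; apply.
apply/(negligibleP m mA); apply: negligibleS aeQ => x Ax Qx; apply: h.
by exists x.
Qed.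

Lemma negligible_dominates (mu m : {measure set X -> \bar R}) (A : set X) :
  m `<< mu -> mu.-negligible A -> m.-negligible A.
Proof.
move=> /null_content_dominatesP h [N [mN N0 AN]]; exists N; split => //.
exact: h.
Qed.

Lemma cme_dominates (mu m : {measure set X -> \bar R}) E :
  m `<< mu -> mu `<< m -> countable_measured_eqv mu E ->
  countable_measured_eqv m E.
Proof.
move=> h /null_content_dominatesP h' [r s t c mE n]; split => // A mA A0.
by apply: (negligible_dominates h); apply: n => //; exact: h'.
Qed.

Context (k : nat -> nat) (p : forall n, 'I_(k n).+2 -> R).
Local Notation Om := (product_space k).
Context (P : probability Om R).
Hypothesis p_gt0 : forall n i, 0 < p (n:=n) i.
Hypothesis p_sum1 : forall n, \sum_(i < (k n).+2) p (n:=n) i = 1.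
Hypothesis P_cyl : forall a n, P (cylinder a n) = (\prod_(i < n) p (a i))%:E.

Lemma prob_preimage_neq0 (m : {measure set X -> \bar R}) (S : X -> Om) B :
  (forall B, measurable B -> (m (S @^-1` B) = 0%E <-> P B = 0%E)) ->
  measurable B -> 0 < prob P B -> m (S @^-1` B) != 0%E.
Proof.
by move=> mP mB; rewrite -prob_gt0// lt0e => /andP[/eqP B0 _]; apply/eqP; rewrite mP.
Qed.

(** On a set where the two cocycles differ by at most [M], the ratio [0] provides
    an element of the full group whose cocycle is below [expR (- (r + M))]. *)
Lemma ratio0_unbounded (mu : {sigma_finite_measure set X -> \bar R})
    (E : set (X * X)) (delta : X * X -> R) (S : X -> Om) :
  countable_measured_eqv mu E -> RN_cocycle mu E delta ->
  asymptotic_ratio_set mu E delta 0 ->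
  iso_mod0 mu P S ->
  {ae mu, forall x, S @` eqv_class E x = eqv_class (@tail_eqv k) (S x)} ->
  unbounded_ratio p P.
Proof.
move=> E_eqv E_rn [_ ratio] [T [mS mT TS ST mP]] orb A mA A0 r.
have mSA := measurable_preS mS mA.
have [A1 [M [mA1 A1A A10 matchA1 bdd]]] :=
  bounded_transfer p_gt0 p_sum1 P_cyl E_eqv E_rn mS mT TS ST mP orb mSA
    (prob_preimage_neq0 mP mA A0).
have A1pos : (0 < mu A1)%E by rewrite lt0e A10 measure_ge0.
have [B [phi [[mB B0 BA] [[_ Ephi] phiA hphi]]]] :=
  ratio _ (expR_gt0 (- (r + M))) A1 mA1 A1pos.
have [|x Bx Ex] := ae_exists mB _ Ephi; first by rewrite gt_eqF.
have A1x := BA _ Bx; have A1phi : A1 (phi x) by apply: phiA; exists x.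
have [_ /(_ _ Ex)[_ [n tl]] _] := matchA1 _ A1x.
exists (S x), (S (phi x)), n; split; [exact: A1A|exact: A1A|exact: tl|].
have := bdd x (phi x) A1x A1phi Ex n tl.
have d0 : 0 < delta (phi x, x).
  by apply: (RN_gt0 E_rn); exact: (eqv_sym E_eqv).
have : ln (delta (phi x, x)) < - (r + M).
  rewrite -[ltRHS]expRK ltr_ln ?posrE ?expR_gt0//.
  by have := hphi x Bx; rewrite subr0 gtr0_norm.
move=> h1; rewrite ler_norml => /andP[h2 _].
rewrite ltr_normr; apply/orP; right; lra.
Qed.

End assembly.

Theorem mainTheorem2 (R : realType)
    (d : measure_display) (X : measurableType d)
    (mu : {sigma_finite_measure set X -> \bar R}) (E : set (X * X))
    (X_standard : standard_borel R X)
    (E_eqv : countable_measured_eqv mu E)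
    (E_ergodic : ergodic_eqv mu E)
    (E_hyperfinite : hyperfinite mu E)
    (E_III0 : type_III0 mu E)
    (dY : measure_display) (Y : measurableType dY)
    (nu : {sigma_finite_measure set Y -> \bar R}) (F : R -> Y -> Y)
    (Y_standard : standard_borel R Y)
    (F_flow : measurable_flow nu F)
    (F_associated : associated_flow mu E nu F)
    (F_B : property_B nu F) :
  ~ product_type mu E.
Proof.
move=> [k [p [P [p_gt0 p_sum1 P_cyl [S isoS orbS]]]]].
have [_ [delta' rn' ratioE]] := E_III0.
have ratio0 : asymptotic_ratio_set mu E delta' 0 by rewrite ratioE; left.
have unb := ratio0_unbounded p_gt0 p_sum1 P_cyl E_eqv rn' ratio0 isoS orbS.
have [m [delta [dZ [Z [pi [xi [T [Psi]]]]]]]] := F_associated.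
move=> [[[m_mu mu_m] rn lac] [[quot mxi xi_min T_aut Tpi]
  [[Phi [mPsi mPhi PhiPsi PsiPhi nuPsi]] conj]]].
have mpi := quotient_measurable quot.
have [Ti [TK TiK mT mTi T0]] := T_aut.
have Em := cme_dominates m_mu mu_m E_eqv.
have [A0 [tau [mA0 A00 escapes]]] := property_B_base Em rn lac mpi mxi xi_min
  TK TiK mT mTi T0 Tpi F_flow mPsi mPhi PhiPsi PsiPhi nuPsi conj F_B.
have [V [mS mV VS SV muP]] := isoS.
have mVS : {ae m, forall x, V (S x) = x} := negligible_dominates m_mu VS.
have morbS : {ae m, forall x, S @` eqv_class E x = eqv_class (@tail_eqv k) (S x)}
  := negligible_dominates m_mu orbS.
have mP B : measurable B -> (m (S @^-1` B) = 0%E <-> P B = 0%E).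
  move=> mB; rewrite -muP//; have mSB := measurable_preS mS mB.
  move/null_content_dominatesP: m_mu => m_mu.
  by move/null_content_dominatesP: mu_m => mu_m; split; [exact: mu_m|exact: m_mu].
have [A1 [M [mA1 A1A A10 matchA1 bdd]]] :=
  bounded_transfer p_gt0 p_sum1 P_cyl Em rn mS mV mVS SV mP morbS mA0 A00.
have [N [mN N0 hN]] := SV.
have mVA := measurable_preT mV mA1.
pose B := V @^-1` A1 `\` N.
have mB : measurable B by exact: measurableD.
have B0 : 0 < prob P B.
  rewrite -prob_gt0// lt0e measure_ge0 andbT; apply/eqP => PB.
  move/eqP: A10; apply; apply/(nullT mS mV mVS mP mA1).
  apply/(negligibleP P mVA); apply: (@negligibleS _ _ _ P (B `|` N)).
    by move=> z Vz; case: (pselect (N z)) => Nz; [right|left].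
  by apply: negligibleU; exact/negligibleP.
pose t j := Num.max (tau j) (ln (2 * (`|M| + 1))).
have [s [K [ts mK K0 KB recur]]] :=
  recurrent_scales p_gt0 p_sum1 P_cyl t unb mB B0.
have taus j : tau j <= s j by apply: le_trans (ts j); rewrite le_max lexx.
have Ms j : 2 * (`|M| + 1) <= expR (s j).
  have M1 : 0 < 2 * (`|M| + 1) by rewrite mulr_gt0// ltr_wpDl.
  rewrite -[leLHS](lnK (x := 2 * (`|M| + 1))) ?posrE// ler_expR.
  by apply: le_trans (ts j); rewrite le_max lexx orbT.
have aem := ae_matched Em mVS morbS.
have [x Kx [[VSx _ matchx] esc]] := ae_exists (measurable_preS mS mK)
  (prob_preimage_neq0 mP mK K0) (filterI aem (escapes s taus)).
have A1x : A1 x by have [+ _] := KB _ Kx; rewrite /preimage /= VSx.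
have [j0 hj0] := esc (A1A _ A1x).
have [j jj0 [z' [n [[A1z _] tl /andP[lo hi]]]]] := recur _ Kx j0.
have [Ex Sz] : E (x, V z') /\ S (V z') = z' by apply: matchx; exists n.
apply: (hj0 j jj0); exists (V z'); split => //; first exact: A1A.
have := bdd x (V z') A1x A1z Ex n; rewrite Sz => /(_ tl).
by move=> LD; exact: window_perturb LD (Ms j) lo hi.
Qed.
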